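(* Suppose $\mathbf{C}=\mathbf{V}^\top\mathbf{V}$ with $\mathbf{V}\in\mathbb{R}^{d\times d}$ full rank, and let $\mathcal{X}=\{\mathbf{x}\in[0,1]^d:\ \mathbf{1}^\top\mathbf{x}=s,\ \mathbf{A}\mathbf{x}\le\mathbf{b}\}$ (with or without the additional linear constraints $\mathbf{A}\mathbf{x}\le\mathbf{b}$). Then: (i) $\mathrm{Opt}_{\text{linx-o}}\ \ge\ \tfrac12\big[\mathrm{Opt}_{\Gamma}+\mathrm{Opt}_{\Gamma^c}\big]$; (ii) $\mathrm{Opt}_{\text{linx-d}}\ \ge\ \tfrac12\big[\mathrm{Opt}_{\Gamma\text{-g}}+\mathrm{Opt}_{\Gamma^c\text{-g}}\big]$.
   Context: $1\le s\le d-1$ is an integer. $\mathrm{Diag}(\mathbf{x})$ is the diagonal matrix with diagonal $\mathbf{x}$, $\mathbf{1}$ is the all-ones vector, $\exp$ is applied componentwise, $\boldsymbol{\lambda}(\mathbf{X})$ is the vector of eigenvalues of the symmetric matrix $\mathbf{X}$ in nonincreasing order. $\mathbb{K}_{o,d}=\{\mathbf{x}\in\mathbb{R}^d: x_1\ge\dots\ge x_d\}$. $\mathbf{u}\succcurlyeq_m\mathbf{w}$ means $\sum_i u_i=\sum_i w_i$ and for each $j\le d-1$ the sum of the $j$ largest entries of $\mathbf{u}$ is at least that of $\mathbf{w}$. For an integer $1\le r\le d$ and a real symmetric $d\times d$ matrix $\mathbf{X}$, with $-\log t=+\infty$ for $t\le0$, $$G_r(\mathbf{X})=\min_{\boldsymbol{\xi}\in\mathbb{R}^d_+}\Big\{-\sum_{i=1}^r\log\xi_i:\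 \boldsymbol{\xi}\succcurlyeq_m\boldsymbol{\lambda}(\mathbf{X}),\ \boldsymbol{\xi}\in\mathbb{K}_{o,d}\Big\}.$$ Define $$f_{\text{linx-d}}(\mathbf{x},\boldsymbol{\rho},\boldsymbol{\omega})=-\tfrac12\log\det\!\big(\mathbf{C}\,\mathrm{Diag}(\exp(\boldsymbol{\rho}))\mathrm{Diag}(\mathbf{x})\mathbf{C}+\mathrm{Diag}(\exp(\boldsymbol{\omega}))\mathrm{Diag}(\mathbf{1}-\mathbf{x})\big)+\tfrac12\sum_{i}x_i\rho_i+\tfrac12\sum_{i}(1-x_i)\omega_i,$$ $$f_{\text{linx-o}}(\mathbf{x},\rho_0)=-\tfrac12\log\det\!\big(e^{\rho_0}\mathbf{C}\,\mathrm{Diag}(\mathbf{x})\mathbf{C}+\mathrm{Diag}(\mathbf{1}-\mathbf{x})\big)+\tfrac12 s\rho_0,$$ $$f_{\Gamma\text{-g}}(\mathbf{x},\boldsymbol{\rho})=G_s\big(\mathbf{V}\mathrm{Diag}(\exp(\boldsymbol{\rho}))\mathrm{Diag}(\mathbf{x})\mathbf{V}^\top\big)+\sum_i x_i\rho_i,$$ $$f_{\Gamma^c\text{-g}}(\mathbf{x},\boldsymbol{\omega})=G_{d-s}\big(\mathbf{V}^{-\top}\mathrm{Diag}(\exp(\boldsymbol{\omega}))\mathrm{Diag}(\mathbf{1}-\mathbf{x})\mathbf{V}^{-1}\big)-\log\det(\mathbf{C})+\sum_i(1-x_i)\omega_i .$$ The bounds are (min/max understood as inf/sup) $$\mathrm{Opt}_{\text{linx-o}}=\min_{\mathbf{x}\in\mathcal{X}}\max_{\rho_0\in\mathbb{R}}f_{\text{linx-o}}(\mathbf{x},\rho_0),\qquad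 \mathrm{Opt}_{\text{linx-d}}=\min_{\mathbf{x}\in\mathcal{X}}\max_{\boldsymbol{\rho},\boldsymbol{\omega}\in\mathbb{R}^d}f_{\text{linx-d}}(\mathbf{x},\boldsymbol{\rho},\boldsymbol{\omega}),$$ $$\mathrm{Opt}_{\Gamma}=\min_{\mathbf{x}\in\mathcal{X}}f_{\Gamma\text{-g}}(\mathbf{x},\mathbf{0}),\quad \mathrm{Opt}_{\Gamma^c}=\min_{\mathbf{x}\in\mathcal{X}}f_{\Gamma^c\text{-g}}(\mathbf{x},\mathbf{0}),\quad \mathrm{Opt}_{\Gamma\text{-g}}=\min_{\mathbf{x}\in\mathcal{X}}\max_{\boldsymbol{\rho}\in\mathbb{R}^d}f_{\Gamma\text{-g}}(\mathbf{x},\boldsymbol{\rho}),\quad \mathrm{Opt}_{\Gamma^c\text{-g}}=\min_{\mathbf{x}\in\mathcal{X}}\max_{\boldsymbol{\omega}\in\mathbb{R}^d}f_{\Gamma^c\text{-g}}(\mathbf{x},\boldsymbol{\omega}).$$ *)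

(* Defs.v *)
From HB Require Import structures.
From mathcomp Require Import all_boot all_order all_algebra.
From mathcomp Require Import all_classical all_reals all_analysis.
From mathcomp Require Import complex.

Set Implicit Arguments.
Unset Strict Implicit.
Unset Printing Implicit Defensive.

Import Order.TTheory GRing.Theory Num.Theory.
Local Open Scope classical_set_scope.
Local Open Scope ring_scope.

(* Vectors of R^d are column vectors, with entries [x i 0].

   Objective values live in [\bar R]. The library's [lne] satisfies
   [lne t%:E = -oo] for [t <= 0], so [- lne t%:E] is exactly [-log t] with the
   convention [-log t = +oo] for [t <= 0]. *)
Section Defs.
Variable R : realType.

Definition Diag d (x : 'cV[R]_d) : 'M[R]_d := diag_mx x^T.

Definition expv d (x : 'cV[R]_d) : 'cV[R]_d := map_mx expR x.

Definition onev d : 'cV[R]_d := const_mx 1.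

Definition Kod d : set 'cV[R]_d :=
  [set x | forall i j : 'I_d, (i <= j)%N -> x j 0 <= x i 0].

Definition nonnegv d : set 'cV[R]_d := [set x | forall i : 'I_d, 0 <= x i 0].

(* Sum of the j largest entries of u. *)
Definition topsum d (u : 'cV[R]_d) (j : nat) : R :=
  \sum_(t <- take j (sort >=%R [seq u i 0 | i <- enum 'I_d])) t.

Definition majorizes d (u w : 'cV[R]_d) : Prop :=
  \sum_(i < d) u i 0 = \sum_(i < d) w i 0 /\
  (forall j : nat, (j <= d - 1)%N -> topsum w j <= topsum u j).

(* The eigenvalues of X, with multiplicity, in nonincreasing order. Such a
   vector is unique when it exists, and exists whenever X is symmetric
   (eigvals_sym below); otherwise the value is junk. *)
Definition eigvals d (X : 'M[R]_d) : 'cV[R]_d :=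
  xget 0 [set l | Kod l /\ char_poly X = \prod_(i < d) ('X - (l i 0)%:P)].

Lemma eigvals_sym d (X : 'M[R]_d) : X^T = X ->
  Kod (eigvals X) /\ char_poly X = \prod_(i < d) ('X - (eigvals X i 0)%:P).
Proof.
move=> symX; rewrite /eigvals.
set P := (P in xget _ P); suff: exists l, P l by move/(xgetPex 0).
set f := (real_complex R).
have realf x : f x \is Num.real by apply/complex_realP; exists x.
pose Y := map_mx f X.
have realY : Y \is a mxOver Num.real.
  by apply/mxOverP => i j; rewrite !mxE; exact: realf.
have hY : Y \is hermsymmx.
  apply: realsym_hermsym => //.
  by apply/is_hermitianmxP; rewrite expr0 scale1r map_mx_id // /Y map_trmx symX.
have /orthomx_spectralP := hermitian_normalmx hY.
set Q := spectralmx Y; set sp := spectral_diag Y => defY.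
have /mxOverP realsp := hermitian_spectral_diag_real hY.
have uQ : Q \in unitmx by exact: spectral_unit.
pose l0 := [seq complex.Re (sp 0 i) | i <- enum 'I_d].
have cX : char_poly X = \prod_(t <- l0) ('X - t%:P).
  apply: (map_poly_inj f); rewrite map_char_poly -/Y defY.
  have -> : char_poly (invmx Q *m diag_mx sp *m Q) = char_poly (diag_mx sp).
    rewrite /char_poly /char_poly_mx !map_mxM /=.
    set q := map_mx polyC Q.
    have uq : q \in unitmx by rewrite map_unitmx.
    have -> : map_mx polyC (invmx Q) = invmx q by rewrite -map_invmx.
    have -> : 'X%:M - invmx q *m map_mx polyC (diag_mx sp) *m q =
      invmx q *m ('X%:M - map_mx polyC (diag_mx sp)) *m q.
      by rewrite mulmxBr mulmxBl scalar_mxC mulmxKV.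
    by rewrite !det_mulmx mulrAC -det_mulmx mulVmx // det1 mul1r.
  rewrite char_poly_trig; last exact/is_diag_mx_is_trig/diag_mx_is_diag.
  rewrite rmorph_prod big_map big_enum /=; apply: eq_bigr => i _.
  rewrite rmorphB /= map_polyX map_polyC /= mxE eqxx mulr1n.
  by rewrite /f /= RRe_real.
pose l1 := sort >=%R l0.
have sz : size l1 = d by rewrite size_sort size_map size_enum_ord.
exists (\col_i nth 0 l1 i); split.
  move=> i j ij; rewrite !mxE.
  apply: (@sorted_leq_nth _ (fun x y : R => y <= x)) => //.
  - by move=> x y z /[swap]; exact: le_trans.
  - by apply: sort_sorted => x y; exact: le_total.
  - by rewrite inE sz.
  - by rewrite inE sz.
rewrite cX (perm_big l1) /=; last by rewrite perm_sym perm_sort.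
rewrite (big_nth 0) sz big_mkord.
by apply: eq_bigr => i _; rewrite mxE.
Qed.

Definition feasible d m (s : nat) (A : 'M[R]_(m, d)) (b : 'cV[R]_m)
    : set 'cV[R]_d :=
  [set x : 'cV[R]_d | [/\ forall i : 'I_d, 0 <= x i 0 <= 1,
               \sum_(i < d) x i 0 = s%:R
             & forall k : 'I_m, (A *m x) k 0 <= b k 0]].

Local Open Scope ereal_scope.

(* The i-th entry of xi, 1 <= i <= r, is indexed by [i < r] with i : 'I_d. *)
Definition G d (r : nat) (X : 'M[R]_d) : \bar R :=
  ereal_inf [set \sum_(i < d | (i < r)%N) - lne (xi i 0)%:E
            | xi in [set xi : 'cV[R]_d |
                [/\ nonnegv xi, majorizes xi (eigvals X) & Kod xi]]].

Definition f_linx_d d (C : 'M[R]_d) (x rho omega : 'cV[R]_d) : \bar R :=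
  (2^-1)%:E *
    - lne (\det (C *m Diag (expv rho) *m Diag x *m C
                 + Diag (expv omega) *m Diag (onev d - x)))%:E
  + (2^-1 * \sum_(i < d) x i 0 * rho i 0)%:E
  + (2^-1 * \sum_(i < d) (1 - x i 0) * omega i 0)%:E.

Definition f_linx_o d (C : 'M[R]_d) (s : nat) (x : 'cV[R]_d) (rho0 : R)
    : \bar R :=
  (2^-1)%:E *
    - lne (\det (expR rho0 *: (C *m Diag x *m C) + Diag (onev d - x)))%:E
  + (2^-1 * s%:R * rho0)%:E.

Definition f_Gamma_g d (V : 'M[R]_d) (s : nat) (x rho : 'cV[R]_d) : \bar R :=
  G s (V *m Diag (expv rho) *m Diag x *m V^T)
  + (\sum_(i < d) x i 0 * rho i 0)%:E.

Definition f_Gammac_g d (C V : 'M[R]_d) (s : nat) (x omega : 'cV[R]_d)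
    : \bar R :=
  G (d - s) (invmx V^T *m Diag (expv omega) *m Diag (onev d - x) *m invmx V)
  - lne (\det C)%:E
  + (\sum_(i < d) (1 - x i 0) * omega i 0)%:E.

Definition Opt_linx_o d (C : 'M[R]_d) (s : nat) (X : set 'cV[R]_d) : \bar R :=
  ereal_inf [set ereal_sup [set f_linx_o C s x rho0 | rho0 in [set: R]]
            | x in X].

Definition Opt_linx_d d (C : 'M[R]_d) (X : set 'cV[R]_d) : \bar R :=
  ereal_inf [set ereal_sup [set f_linx_d C x p.1 p.2
                           | p in [set: 'cV[R]_d * 'cV[R]_d]]
            | x in X].

Definition Opt_Gamma d (V : 'M[R]_d) (s : nat) (X : set 'cV[R]_d) : \bar R :=
  ereal_inf [set f_Gamma_g V s x 0%R | x in X].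

Definition Opt_Gammac d (C V : 'M[R]_d) (s : nat) (X : set 'cV[R]_d)
    : \bar R :=
  ereal_inf [set f_Gammac_g C V s x 0%R | x in X].

Definition Opt_Gamma_g d (V : 'M[R]_d) (s : nat) (X : set 'cV[R]_d) : \bar R :=
  ereal_inf [set ereal_sup [set f_Gamma_g V s x rho | rho in [set: 'cV[R]_d]]
            | x in X].

Definition Opt_Gammac_g d (C V : 'M[R]_d) (s : nat) (X : set 'cV[R]_d)
    : \bar R :=
  ereal_inf [set ereal_sup [set f_Gammac_g C V s x omega
                           | omega in [set: 'cV[R]_d]]
            | x in X].

End Defs.

(* Main.v *)
Require Import Defs.
From HB Require Import structures.
From mathcomp Require Import all_boot all_order all_algebra.
From mathcomp Require Import all_classical all_reals all_analysis.
From mathcomp Require Import ring lra.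
Import Order.TTheory GRing.Theory Num.Theory.
Local Open Scope ring_scope.

(** Why the theorem holds.

    Write M = V Diag(e^rho) Diag(x) V^T and
    N = V^-T Diag(e^omega) Diag(1 - x) V^-1.  Since C = V^T V, the matrix in
    the linx objective is V^T (M + N) V, so its determinant is
    det C * det (M + N); adding a constant t to rho replaces M by e^t M and
    adds s t / 2 to the linear term.  Both parts therefore reduce, for a fixed
    feasible x, to one statement about positive semidefinite M and N:

      if c z^s <= det (z M + N) for all z > 0, then
      G_s(M) + G_(d-s)(N) <= - log c        ([G_add_le]).

    To prove it, diagonalize M and N by one congruence: M = S diag(a) S^T and
    N = S diag(b) S^T ([simultaneous_congruence]), so that the hypothesis
    concerns the polynomial prod (z a_i + b_i).  If z is stationary for
    sum log (z a_i + b_i) - s log z, then the numbers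
    x_i = z a_i / (z a_i + b_i) lie in [0,1] and add up to s; the extreme cases
    z = 0 and z = oo are limits, and [balancing_weights] treats all of them
    together.  With w_i = z a_i + b_i this writes z M and N as
    S diag(w x) S^T and S diag(w (1 - x)) S^T.

    The vector x is a convex combination of indicators of s-element sets T.
    For such an indicator the two matrices have ranks at most s and d - s and
    their sum is W = S diag(w) S^T.  Choosing s eigenvectors of the first and
    d - s of the second as the rows of a matrix B with unit rows gives
    W = B^T diag(eigenvalues) B, and Hadamard's inequality |det B| <= 1 yields
    det W <= product of the s top eigenvalues of the first times the product of
    the d - s top eigenvalues of the second
    ([det_add_le_prod_top_eigvals]).  The spectra are thus good candidates xi
    in the two minimization problems.  Averaging the candidates over T keeps
    them feasible for the averaged matrices, because sums of top eigenvalues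
    are convex in the matrix (Ky Fan), and the objective only improves, because
    log is concave ([admissible_pair], by [hypersimplex_ind]).  Finally a
    feasible xi for a smaller matrix becomes feasible for a larger one by
    adding the missing trace to its first entry ([G_le_dominates]). *)

(** * Orthogonal diagonalization of real symmetric matrices *)
Section Spectral.
Set Implicit Arguments.
Unset Strict Implicit.
Variable R : realType.

Definition quad_form n (M : 'M[R]_n) (v : 'rV[R]_n) : R := (v *m M *m v^T) 0 0.

Definition psd n (M : 'M[R]_n) := M^T = M /\ forall v, 0 <= quad_form M v.

Lemma dot_ge0 n (v : 'rV[R]_n) : 0 <= (v *m v^T) 0 0.
Proof. by rewrite mxE sumr_ge0 // => i _; rewrite mxE -expr2 sqr_ge0. Qed.

Lemma dot_eq0 n (v : 'rV[R]_n) : (v *m v^T) 0 0 = 0 -> v = 0.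
Proof.
rewrite mxE => /eqP; rewrite psumr_eq0 => [/allP h|i _]; last first.
  by rewrite mxE -expr2 sqr_ge0.
apply/rowP => i; have := h i (mem_index_enum _).
by rewrite !mxE /= mulf_eq0 orbb => /eqP.
Qed.

(** The Householder reflection exchanging v and the first basis vector e, that
    is, the reflection in the hyperplane orthogonal to v - e. *)
Lemma orthogonal_first_row n (v : 'rV[R]_(1 + n)) : (v *m v^T) 0 0 = 1 ->
  exists H : 'M[R]_(1 + n), H *m H^T = 1%:M /\ delta_mx 0 0 *m H = v.
Proof.
move=> v1; pose e : 'rV[R]_(1 + n) := delta_mx 0 0.
have [u uE] : exists u, u = v - e by exists (v - e).
pose q := (u *m u^T) 0 0.
have ev : (e *m v^T) 0 0 = v 0 0 by rewrite /e -rowE !mxE.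
have ee : (e *m e^T) 0 0 = 1 by rewrite /e -rowE !mxE !eqxx.
have ve : (v *m e^T) 0 0 = v 0 0 by rewrite /e trmx_delta -colE mxE.
have qE : q = 2 - 2 * v 0 0.
  rewrite /q uE linearB /= mulmxBl !mulmxBr.
  have -> : (v *m v^T - v *m e^T - (e *m v^T - e *m e^T)) 0 0 =
    (v *m v^T) 0 0 - (v *m e^T) 0 0 - ((e *m v^T) 0 0 - (e *m e^T) 0 0).
    by rewrite !mxE.
  by rewrite v1 ve ev ee; ring.
have [q0|q0] := eqVneq q 0.
  exists 1%:M; rewrite trmx1 mulmx1 mulmx1; split=> //.
  by have /eqP := dot_eq0 q0; rewrite uE subr_eq0 => /eqP.
have uu : u *m u^T = q%:M by apply/matrixP => i j; rewrite !ord1 [RHS]mxE mulr1n.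
exists (1%:M - (2 / q) *: (u^T *m u)); split.
  have -> : (1%:M - (2 / q) *: (u^T *m u))^T = 1%:M - (2 / q) *: (u^T *m u).
    by rewrite linearB linearZ /= trmx1 trmx_mul trmxK.
  rewrite mulmxBl mul1mx mulmxBr mulmx1 -scalemxAl -scalemxAr.
  have -> : u^T *m u *m (u^T *m u) = q *: (u^T *m u).
    by rewrite mulmxA -(mulmxA u^T u) uu -mulmxA mul_scalar_mx scalemxAr.
  rewrite !scalerA -scalerBl -addrA -opprD -scalerDl.
  have -> : 2 / q + (2 / q - 2 / q * (2 / q) * q) = 0 by field.
  by rewrite scale0r subr0.
rewrite mulmxBr mulmx1 -/e -scalemxAr mulmxA.
have -> : e *m u^T = (- (q / 2))%:M.
  apply/matrixP => i j; rewrite !ord1 [RHS]mxE mulr1n uE linearB /= mulmxBr.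
  have -> : (e *m v^T - e *m e^T) 0 0 = (e *m v^T) 0 0 - (e *m e^T) 0 0.
    by rewrite !mxE.
  by rewrite ev ee qE; field.
rewrite mul_scalar_mx scalerA mulrN mulrA divfK // divff // scaleN1r opprK.
by rewrite uE addrC subrK.
Qed.

Lemma char_poly_conj n (P Q X : 'M[R]_n) : P *m Q = 1%:M ->
  char_poly (P *m X *m Q) = char_poly X.
Proof.
move=> PQ; rewrite /char_poly /char_poly_mx.
have pq : map_mx polyC P *m map_mx polyC Q = 1%:M by rewrite -map_mxM PQ map_mx1.
have -> : 'X%:M - map_mx polyC (P *m X *m Q) =
    map_mx polyC P *m ('X%:M - map_mx polyC X) *m map_mx polyC Q.
  rewrite !map_mxM /= mulmxBr mulmxBl.
  by rewrite scalar_mxC -['X%:M *m _ *m _]mulmxA pq mulmx1.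
by rewrite !det_mulmx mulrAC -det_mulmx pq det1 mul1r.
Qed.

Lemma char_poly_lift0 n (a : R) (X : 'M[R]_n) :
  char_poly (block_mx a%:M 0 0 X : 'M[R]_(1 + n)) = ('X - a%:P) * char_poly X.
Proof.
rewrite /char_poly /char_poly_mx map_block_mx !map_mx0 map_scalar_mx /=.
rewrite (scalar_mx_block 1 n 'X) opp_block_mx add_block_mx !oppr0 !addr0.
rewrite det_lblock -raddfB /= det_scalar1 //.
Qed.

(** Induction on the dimension: a unit eigenvector for the first listed
    eigenvalue is rotated onto the first basis vector, which splits the matrix
    into blocks, and that factor cancels in the characteristic polynomial.
    Taking the eigenvalues as a given factorization, rather than producing
    them, keeps their order, so no sorting is needed afterwards. *)
Theorem real_spectral n (X : 'M[R]_n) (l : 'rV[R]_n) : X^T = X ->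
  char_poly X = \prod_(i < n) ('X - (l 0 i)%:P) ->
  exists U : 'M[R]_n, U *m U^T = 1%:M /\ X = U^T *m diag_mx l *m U.
Proof.
elim: n X l => [|n IHn].
  move=> X l _ _.
  by exists 1%:M; rewrite trmx1 mulmx1; split=> //; rewrite flatmx0 [RHS]flatmx0.
rewrite -[n.+1]/(1 + n)%N => X l symX cX.
have /eigenvalueP[v0 v0X v0N0] : eigenvalue X (l 0 0).
  by rewrite eigenvalue_root_char cX big_ord_recl rootM root_XsubC eqxx.
pose nv := (v0 *m v0^T) 0 0.
have nv_gt0 : 0 < nv.
  by rewrite lt0r dot_ge0 andbT; apply: contraNneq v0N0 => /dot_eq0 ->.
pose v : 'rV[R]_(1 + n) := (Num.sqrt nv)^-1 *: v0.
have vX : v *m X = l 0 0 *: v by rewrite -scalemxAl v0X !scalerA mulrC.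
have vv : (v *m v^T) 0 0 = 1.
  rewrite /v linearZ /= -scalemxAl -scalemxAr scalerA mxE -/nv -invfM -expr2.
  by rewrite sqr_sqrtr ?ltW // mulVf // gt_eqF.
have [H [HH eH]] := orthogonal_first_row vv.
have HtH : H^T *m H = 1%:M by apply: mulmx1C.
pose Y : 'M[R]_(1 + n) := H *m X *m H^T.
have symY : Y^T = Y by rewrite /Y !trmx_mul trmxK symX mulmxA.
have cY : char_poly Y = char_poly X by exact: char_poly_conj.
have row0 : (delta_mx 0 0 : 'rV[R]_(1 + n)) *m Y = l 0 0 *: delta_mx 0 (0 : 'I_(1 + n)).
  by rewrite /Y !mulmxA eH vX -scalemxAl -eH -mulmxA HH mulmx1.
have Y0 j : Y 0 j = l 0 0 *+ (j == 0).
  by have := congr1 (fun M : 'rV[R]_(1 + n) => M 0 j) row0;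
     rewrite -rowE !mxE eqxx mulr_natr.
pose X' := drsubmx Y.
have YE : Y = block_mx (l 0 0)%:M 0 0 X'.
  rewrite -[LHS]submxK; congr block_mx.
  - apply/matrixP => i j; rewrite !ord1 mxE mxE lshift0 Y0 mxE.
    by rewrite -val_eqE.
  - apply/matrixP => i j; rewrite !ord1 mxE mxE lshift0 Y0 mxE.
    by rewrite -val_eqE.
  - apply/matrixP => i j; rewrite !ord1 mxE mxE lshift0 -symY mxE Y0 mxE.
    by rewrite -val_eqE.
have symX' : X'^T = X' by rewrite /X' trmx_drsub symY.
have cX' : char_poly X' = \prod_(i < n) ('X - (rsubmx l 0 i)%:P).
  apply: (mulfI (x := 'X - (l 0 0)%:P)); first by rewrite polyXsubC_eq0.
  rewrite -char_poly_lift0 -YE cY cX big_ord_recl; congr (_ * _).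
  by apply: eq_bigr => i _; rewrite mxE rshift1.
have [U' [UU' X'E]] := IHn _ _ symX' cX'.
pose U0 : 'M[R]_(1 + n) := block_mx 1%:M 0 0 U'.
have UU0 : U0 *m U0^T = 1%:M.
  rewrite /U0 tr_block_mx mulmx_block !trmx0 !mulmx0 !mul0mx !addr0 add0r UU'.
  by rewrite trmx1 mulmx1 -scalar_mx_block.
exists (U0 *m H); split.
  by rewrite trmx_mul mulmxA -(mulmxA U0) HH mulmx1.
have YE2 : Y = U0^T *m diag_mx l *m U0.
  rewrite YE X'E /U0 tr_block_mx.
  have -> : diag_mx l =
    block_mx (l 0 0)%:M 0 0 (diag_mx (rsubmx l)).
    rewrite -[LHS]submxK; congr block_mx; apply/matrixP => i j; rewrite !mxE.
    - by rewrite !ord1 lshift0.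
    - by rewrite -val_eqE /= !ord1.
    - by rewrite -val_eqE /= !ord1.
    - by rewrite -val_eqE /= eqn_add2l val_eqE; case: eqP => // ->.
  rewrite !mulmx_block !trmx0 !mulmx0 !mul0mx !addr0 !add0r trmx1 mul1mx mulmx1.
  by rewrite !mul0mx.
have -> : X = H^T *m Y *m H.
  by rewrite /Y !mulmxA HtH mul1mx -mulmxA HtH mulmx1.
by rewrite YE2 trmx_mul !mulmxA.
Qed.

End Spectral.

(** * Positive semidefinite matrices, Hadamard's inequality and rank *)
Section Psd.
Set Implicit Arguments.
Unset Strict Implicit.
Variable R : realType.

Lemma quad_form_row m n (M : 'M[R]_n) (B : 'M[R]_(m, n)) i :
  quad_form M (row i B) = (B *m M *m B^T) i i.
Proof.
by rewrite /quad_form -row_mul !mxE; apply: eq_bigr => k _; rewrite !mxE.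
Qed.

Lemma psd_congr m n (M : 'M[R]_n) (B : 'M[R]_(m, n)) :
  psd M -> psd (B *m M *m B^T).
Proof.
move=> [symM M0]; split; first by rewrite !trmx_mul trmxK symM mulmxA.
by move=> v; have := M0 (v *m B); rewrite /quad_form trmx_mul !mulmxA.
Qed.

Lemma quad_form_diag n (l v : 'rV[R]_n) : quad_form (diag_mx l) v = \sum_i l 0 i * v 0 i ^+ 2.
Proof.
rewrite /quad_form mul_mx_diag mxE; apply: eq_bigr => i _; rewrite !mxE.
by rewrite expr2 mulrCA mulrA.
Qed.

Lemma psd_diag n (l : 'rV[R]_n) : (forall i, 0 <= l 0 i) -> psd (diag_mx l).
Proof.
move=> l0; split; first by rewrite tr_diag_mx.
by move=> v; rewrite quad_form_diag sumr_ge0 // => i _; rewrite mulr_ge0 ?sqr_ge0.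
Qed.

Lemma quad_formD n (M N : 'M[R]_n) v : quad_form (M + N) v = quad_form M v + quad_form N v.
Proof. by rewrite /quad_form mulmxDr mulmxDl mxE. Qed.

Lemma psdD n (M N : 'M[R]_n) : psd M -> psd N -> psd (M + N).
Proof.
move=> [sM M0] [sN N0]; split; first by rewrite linearD /= sM sN.
by move=> v; rewrite quad_formD addr_ge0.
Qed.

Lemma sym_eigvals n (M : 'M[R]_n) : M^T = M -> exists U : 'M[R]_n,
  U *m U^T = 1%:M /\ M = U^T *m diag_mx (eigvals M)^T *m U.
Proof.
move=> symM; have [_ cM] := eigvals_sym symM.
apply: real_spectral => //; rewrite cM.
by apply: eq_bigr => i _; rewrite mxE.
Qed.

Lemma orth_diagE n (M U : 'M[R]_n) l : U *m U^T = 1%:M ->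
  M = U^T *m diag_mx l *m U -> U *m M *m U^T = diag_mx l.
Proof.
by move=> UU ->; rewrite !mulmxA UU mul1mx -mulmxA UU mulmx1.
Qed.

Lemma psd_eigvals_ge0 n (M : 'M[R]_n) i : psd M -> 0 <= eigvals M i 0.
Proof.
move=> [symM M0]; have [U [UU ME]] := sym_eigvals symM.
have := M0 (row i U); rewrite quad_form_row (orth_diagE UU ME).
by rewrite !mxE eqxx mulr1n.
Qed.

Lemma trace_eigvals n (M : 'M[R]_n) : M^T = M ->
  \tr M = \sum_i eigvals M i 0.
Proof.
move=> symM; have [U [UU ME]] := sym_eigvals symM.
rewrite {1}ME -mulmxA mxtrace_mulC -mulmxA UU mulmx1 mxtrace_diag.
by apply: eq_bigr => i _; rewrite mxE.
Qed.

Lemma det_eigvals n (M : 'M[R]_n) : M^T = M ->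
  \det M = \prod_i eigvals M i 0.
Proof.
move=> symM; have [U [UU ME]] := sym_eigvals symM.
rewrite {1}ME !det_mulmx mulrAC -det_mulmx (mulmx1C UU) det1 mul1r det_diag.
by apply: eq_bigr => i _; rewrite mxE.
Qed.

(** The Gram matrix of the rows has trace n, so by the inequality between
    arithmetic and geometric means the product of its eigenvalues is at most
    1. *)
Lemma hadamard_unit_rows n (B : 'M[R]_n) :
  (forall i, (B *m B^T) i i = 1) -> \det B ^+ 2 <= 1.
Proof.
move=> B1; set K := B *m B^T.
have psdK : psd K.
  rewrite /K -[B in B *m _]mulmx1 -diag_const_mx; apply/psd_congr/psd_diag => i.
  by rewrite mxE ler01.
have symK : K^T = K by case: psdK.
rewrite expr2 -{2}det_tr -det_mulmx -/K det_eigvals //.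
have := @leif_AGM R 'I_n predT (fun i => eigvals K i 0) (fun i _ => psd_eigvals_ge0 i psdK).
move=> [+ _]; rewrite -trace_eigvals // => /le_trans; apply.
rewrite (eq_card (B := 'I_n)) // card_ord.
have -> : \tr K = n%:R by rewrite /mxtrace (eq_bigr (fun=> 1)) ?sumr_const ?card_ord.
case: n {B B1 K psdK symK} => [|n]; first by rewrite expr0.
by rewrite divff ?expr1n // pnatr_eq0.
Qed.

Lemma rank_diag_le n (l : 'rV[R]_n) (T : {set 'I_n}) :
  (forall i, i \notin T -> l 0 i = 0) -> (\rank (diag_mx l) <= #|T|)%N.
Proof.
move=> lT.
have sub : (diag_mx l <= \sum_(i in T) <<delta_mx 0 i : 'rV[R]_n>>)%MS.
  apply/row_subP => i; have -> : row i (diag_mx l) = l 0 i *: delta_mx 0 i.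
    by apply/rowP => j; rewrite !mxE eqxx /= mulr_natr eq_sym.
  have [iT|/lT ->] := boolP (i \in T); last by rewrite scale0r sub0mx.
  by rewrite scalemx_sub // (sumsmx_sup i) // genmxE.
rewrite (leq_trans (mxrankS sub)) // (leq_trans (mxrank_sum_leqif _).1) //=.
rewrite -sum1_card leq_sum // => i _.
by rewrite mxrank_gen mxrank_delta.
Qed.

Lemma rank_diag_ge n (l : 'rV[R]_n) k : (k <= n)%N ->
  (forall i : 'I_n, (i < k)%N -> l 0 i != 0) -> (k <= \rank (diag_mx l))%N.
Proof.
move=> kn lk.
have -> : k = \rank (pid_mx k : 'M[R]_n) by rewrite rank_pid_mx.
have -> : (pid_mx k : 'M[R]_n) = diag_mx (\row_i ((l 0 i)^-1 *+ (i < k)%N)) *m diag_mx l.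
  rewrite mulmx_diag; apply/matrixP => i j; rewrite !mxE val_eqE.
  have [_|_] := eqVneq i j; last by rewrite !mulr0n.
  rewrite mulr1n /=.
  case: ltnP => ik; last by rewrite mulr0n mul0r.
  by rewrite mulr1n mulVf ?lk.
exact: mxrankM_maxr.
Qed.

(** The eigenvalues are nonincreasing: a positive i-th one would give i + 1
    nonzero eigenvalues, hence rank at least i + 1. *)
Lemma rank_eigvals_eq0 n (M : 'M[R]_n) (i : 'I_n) : psd M ->
  (\rank M <= i)%N -> eigvals M i 0 = 0.
Proof.
move=> psdM rM; have [symM _] := psdM; have [U [UU ME]] := sym_eigvals symM.
have [Kd _] := eigvals_sym symM.
apply/eqP/negP => /negP li.
have li0 : 0 < eigvals M i 0 by rewrite lt0r li psd_eigvals_ge0.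
have : (i.+1 <= \rank (diag_mx (eigvals M)^T))%N.
  apply: rank_diag_ge => // j; rewrite ltnS => ji; rewrite mxE gt_eqF //.
  by rewrite (lt_le_trans li0) // Kd.
rewrite -(orth_diagE UU ME) ltnNge => /negP; apply.
by rewrite (leq_trans _ rM) // (leq_trans (mxrankM_maxl _ _)) // mxrankM_maxr.
Qed.

End Psd.

(** * Ky Fan domination and upper bounds on G *)
Section Dominance.
Set Implicit Arguments.
Unset Strict Implicit.
Variable R : realType.

(** Only s eigenvalues of M and d - s eigenvalues of N can be nonzero.  Placing
    the corresponding eigenvectors in the rows of one square matrix B gives
    M + N = B^T diag(e) B, where e lists these eigenvalues, and Hadamard's
    inequality bounds det B ^ 2 by 1. *)
Lemma det_add_le_prod_top_eigvals d s (M N : 'M[R]_d) : (s <= d)%N -> psd M -> psd N ->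
  (\rank M <= s)%N -> (\rank N <= d - s)%N ->
  \det (M + N) <= (\prod_(i < d | (i < s)%N) eigvals M i 0) *
                  \prod_(i < d | (i < d - s)%N) eigvals N i 0.
Proof.
move=> sd psdM psdN rM rN; have [[symM _] [symN _]] := (psdM, psdN).
have [U [UU ME]] := sym_eigvals symM; have [W [WW NE]] := sym_eigvals symN.
set l := eigvals M in ME *; set m := eigvals N in NE *.
have rev_lt (i : 'I_d) : (rev_ord i < d - s)%N = ~~ (i < s)%N.
  by rewrite /= ltn_sub2lE ?ltn_ord // ltnS leqNgt.
(* Reversing the order of the rows places the d - s top eigenvectors of N in
   the last d - s rows. *)
pose B : 'M[R]_d :=
  \matrix_(i, j) if (i < s)%N then U i j else W (rev_ord i) j.
pose e : 'rV[R]_d := \row_i if (i < s)%N then l i 0 else m (rev_ord i) 0.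
have entry (Q : 'M[R]_d) (q : 'rV[R]_d) i j :
    (Q^T *m diag_mx q *m Q) i j = \sum_k Q k i * q 0 k * Q k j.
  by rewrite mul_mx_diag mxE; apply: eq_bigr => k _; rewrite !mxE.
have MN : M + N = B^T *m diag_mx e *m B.
  rewrite ME NE; apply/matrixP => i j; rewrite mxE !entry.
  rewrite [X in X + _](bigID (fun k : 'I_d => (k < s)%N)) /=.
  rewrite [X in _ + X + _]big1 ?addr0; last first.
    move=> k; rewrite -leqNgt => sk; rewrite mxE /l rank_eigvals_eq0 ?mulr0 ?mul0r //.
    exact: leq_trans sk.
  rewrite [X in _ + X](reindex_inj rev_ord_inj) /=.
  rewrite [X in _ + X](bigID (fun k : 'I_d => (k < s)%N)) /=.
  rewrite [X in _ + (X + _)]big1 ?add0r; last first.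
    move=> k ks; rewrite mxE /m rank_eigvals_eq0 ?mulr0 ?mul0r //.
    by rewrite (leq_trans rN) // leqNgt rev_lt ks.
  rewrite [RHS](bigID (fun k : 'I_d => (k < s)%N)) /=; congr (_ + _).
    by apply: eq_bigr => k ks; rewrite !mxE ks.
  by apply: eq_bigr => k /negPf ks; rewrite !mxE ks.
have B1 i : (B *m B^T) i i = 1.
  have [is_|si] := ltnP i s.
    have <- : (U *m U^T) i i = 1 by rewrite UU mxE eqxx.
    by rewrite !mxE; apply: eq_bigr => k _; rewrite !mxE is_.
  have <- : (W *m W^T) (rev_ord i) (rev_ord i) = 1 by rewrite WW mxE eqxx.
  by rewrite !mxE; apply: eq_bigr => k _; rewrite !mxE ltnNge si.
have e0 i : 0 <= e 0 i by rewrite mxE; case: ifP => _; apply: psd_eigvals_ge0.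
have eE : (\prod_(i < d | (i < s)%N) l i 0) *
    (\prod_(i < d | (i < d - s)%N) m i 0) = \prod_i e 0 i.
  rewrite [RHS](bigID (fun k : 'I_d => (k < s)%N)) /=; congr (_ * _).
    by apply: eq_bigr => k ks; rewrite !mxE ks.
  rewrite (reindex_inj rev_ord_inj) /=; apply: eq_big => [i|i]; first exact: rev_lt.
  by rewrite rev_lt => /negPf ks; rewrite mxE ks.
rewrite eE MN !det_mulmx det_tr det_diag mulrAC -expr2.
by rewrite ler_piMl ?prodr_ge0 // hadamard_unit_rows.
Qed.

(** A relaxation of the orthogonal projections of rank j: the trace against a
    symmetric matrix is still maximized by the sum of its j largest
    eigenvalues, and only quadratic forms have to be estimated. *)
Definition fractional_projection d (j : nat) (P : 'M[R]_d) :=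
  (forall v, 0 <= quad_form P v <= (v *m v^T) 0 0) /\ \tr P = j%:R.

(** Majorization of the spectrum of N by xi, expressed without the spectrum
    through Ky Fan's variational principle.  In this form the relation is
    stable under linear combinations with nonnegative coefficients. *)
Definition dominates d (xi : 'cV[R]_d) (N : 'M[R]_d) :=
  \tr N = \sum_i xi i 0 /\
  forall j P, (j <= d)%N -> fractional_projection j P ->
    \tr (P *m N) <= \sum_(i < d | (i < j)%N) xi i 0.

Lemma dominates_lin d (xi yi : 'cV[R]_d) N M a b : 0 <= a -> 0 <= b ->
  dominates xi N -> dominates yi M -> dominates (a *: xi + b *: yi) (a *: N + b *: M).
Proof.
move=> a0 b0 [tN dN] [tM dM]; split.
  rewrite linearD !linearZ /= tN tM !mulr_sumr -big_split /=.
  by apply: eq_bigr => i _; rewrite !mxE.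
move=> j P jd fP; rewrite mulmxDr -!scalemxAr linearD !linearZ /=.
under eq_bigr do rewrite !mxE.
by rewrite big_split /= -!mulr_sumr lerD // ler_wpM2l // ?dN ?dM.
Qed.

Lemma dominatesZ d (xi : 'cV[R]_d) N a : 0 <= a -> dominates xi N -> dominates (a *: xi) (a *: N).
Proof.
move=> a0 dN; have := dominates_lin a0 (lexx 0) dN dN.
by rewrite !scale0r !addr0.
Qed.

Lemma sum_ord_lt d j : (j <= d)%N -> \sum_(i < d) ((i < j)%N)%:R = j%:R :> R.
Proof.
move=> jd; rewrite -natr_sum -big_mkcond /=.
by rewrite -(big_ord_widen d (fun=> 1%N)) // sum1_card card_ord.
Qed.

(** A threshold c separating the first j values from the others makes every
    term of the sum of ([i < j] - t_i) (l_i - c) nonnegative, while the weights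
    [i < j] - t_i add up to 0. *)
Lemma weighted_sum_le_top d (l : 'cV[R]_d) (t : 'I_d -> R) j :
  nonnegv l -> Kod l -> (j <= d)%N ->
  (forall i, 0 <= t i <= 1) -> \sum_i t i = j%:R ->
  \sum_i t i * l i 0 <= \sum_(i < d | (i < j)%N) l i 0.
Proof.
move=> l0 Kl jd t01 tj.
(* For j = d no entry lies beyond the first j, and 0 is a threshold. *)
have [c lec gec] : exists2 c, forall i : 'I_d, (i < j)%N -> c <= l i 0 &
                              forall i : 'I_d, (j <= i)%N -> l i 0 <= c.
  case: (ltnP j d) => [jd'|dj].
    exists (l (Ordinal jd') 0) => i ij; apply: Kl => //=; exact: ltnW.
  exists 0 => i ij; first exact: l0.
  by have := leq_trans dj ij; rewrite leqNgt ltn_ord.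
rewrite [leRHS]big_mkcond -subr_ge0 -sumrB /=.
have -> : \sum_(i < d) ((if (i < j)%N then l i 0 else 0) - t i * l i 0) =
    \sum_(i < d) (((i < j)%N)%:R - t i) * (l i 0 - c).
  transitivity (\sum_(i < d) (((i < j)%N)%:R - t i) * (l i 0 - c) +
                \sum_(i < d) (((i < j)%N)%:R - t i) * c).
    by rewrite -big_split /=; apply: eq_bigr => i _; case: ifP => _ /=; ring.
  rewrite -[X in _ + X]mulr_suml sumrB tj sum_ord_lt //.
  by rewrite subrr mul0r addr0.
apply: sumr_ge0 => i _; have /andP[t0 t1] := t01 i; have [ij|ji] := ltnP i j.
  by rewrite mulr_ge0 // subr_ge0 // lec.
by rewrite mulr_le0 // subr_le0 // gec.
Qed.

Lemma dominates_eigvals d (N : 'M[R]_d) : psd N -> dominates (eigvals N) N.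
Proof.
move=> psdN; have [symN _] := psdN; split; first exact: trace_eigvals.
move=> j P jd [P01 trP]; have [U [UU NE]] := sym_eigvals symN.
have [Kd _] := eigvals_sym symN.
have -> : \tr (P *m N) = \sum_i (U *m P *m U^T) i i * eigvals N i 0.
  rewrite {1}NE !mulmxA mxtrace_mulC !mulmxA mul_mx_diag.
  by apply: eq_bigr => i _; rewrite !mxE.
apply: weighted_sum_le_top => //.
- by move=> i; apply: psd_eigvals_ge0.
- move=> i; rewrite -quad_form_row; have := P01 (row i U).
  suff -> : (row i U *m (row i U)^T) 0 0 = 1 by [].
  have <- : (U *m U^T) i i = 1 by rewrite UU mxE eqxx.
  by rewrite !mxE; apply: eq_bigr => k _; rewrite !mxE.
- by rewrite -/(mxtrace _) mxtrace_mulC mulmxA (mulmx1C UU) mul1mx.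
Qed.

(** P is the projection onto the span of the first j eigenvectors. *)
Lemma trace_top_eigvals d j (M : 'M[R]_d) : (j <= d)%N -> M^T = M ->
  exists2 P, fractional_projection j P & \tr (P *m M) = \sum_(i < d | (i < j)%N) eigvals M i 0.
Proof.
move=> jd symM; have [U [UU ME]] := sym_eigvals symM.
pose c : 'rV[R]_d := \row_i ((i < j)%N)%:R.
exists (U^T *m diag_mx c *m U).
  split.
    move=> v; have -> : quad_form (U^T *m diag_mx c *m U) v = quad_form (diag_mx c) (v *m U^T).
      by rewrite /quad_form trmx_mul trmxK !mulmxA.
    have -> : (v *m v^T) 0 0 = quad_form (diag_mx (const_mx 1)) (v *m U^T).
      by rewrite /quad_form diag_const_mx mulmx1 trmx_mul trmxK mulmxA -[v *m _ *m _]mulmxA (mulmx1C UU) mulmx1.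
    rewrite !quad_form_diag; apply/andP; split.
      by apply: sumr_ge0 => i _; rewrite mulr_ge0 ?sqr_ge0 // mxE ler0n.
    apply: ler_sum => i _; rewrite ler_wpM2r ?sqr_ge0 // !mxE.
    by case: (_ < _)%N; rewrite ?ler01.
  rewrite -mulmxA mxtrace_mulC -mulmxA UU mulmx1 mxtrace_diag.
  rewrite -(sum_ord_lt jd); apply: eq_bigr => i _; exact: mxE.
rewrite {1}ME !mulmxA mxtrace_mulC !mulmxA UU mul1mx -[_ *m U *m U^T]mulmxA UU mulmx1.
rewrite mulmx_diag mxtrace_diag [RHS]big_mkcond /=; apply: eq_bigr => i _; rewrite !mxE.
by case: ifP => _; rewrite ?mul1r ?mul0r.
Qed.

Lemma topsumE d (u : 'cV[R]_d) j : Kod u -> (j <= d)%N ->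
  topsum u j = \sum_(i < d | (i < j)%N) u i 0.
Proof.
move=> Ku jd; rewrite /topsum; set s := map _ _.
have sz : size s = d by rewrite size_map size_enum_ord.
have nths (i : 'I_d) : nth 0 s i = u i 0.
  by rewrite (nth_map i) ?size_enum_ord // nth_ord_enum.
rewrite sorted_sort; first last.
- apply/(sortedP 0) => i; rewrite sz => id.
  rewrite (nths (Ordinal id)) (nths (Ordinal (ltnW id))).
  by apply: Ku => /=.
- by move=> x y z /[swap]; exact: le_trans.
rewrite (big_nth 0) size_take sz.
have -> : (if (j < d)%N then j else d) = j.
  by case: ltnP => // dj; apply/eqP; rewrite eqn_leq dj jd.
rewrite big_mkord; under eq_bigr => i _ do rewrite nth_take //.
by rewrite (big_ord_widen d (nth 0 s)) //; apply: eq_bigr.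
Qed.

Lemma Kod_eigvals d (M : 'M[R]_d) : M^T = M -> Kod (eigvals M).
Proof. by move=> symM; case: (eigvals_sym symM). Qed.

(** The candidate is xi with tr (X - Y) added to its first entry: this restores
    the total and covers the contribution of X - Y to every partial sum. *)
Lemma G_le_dominates d r (X Y : 'M[R]_d) (xi : 'cV[R]_d) : (0 < d)%N -> X^T = X ->
  psd (X - Y) -> dominates xi Y -> nonnegv xi -> Kod xi ->
  (forall i : 'I_d, (i < r)%N -> 0 < xi i 0) ->
  (G r X <= (\sum_(i < d | (i < r)%N) - ln (xi i 0))%:E)%E.
Proof.
move=> d0 symX psdE [trY domY] xi0 Kxi xir.
pose tau := \tr (X - Y).
have tau0 : 0 <= tau.
  rewrite /tau trace_eigvals; last by case: psdE.
  by apply: sumr_ge0 => i _; apply: psd_eigvals_ge0.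
pose xi' : 'cV[R]_d := \col_i (xi i 0 + (if i == Ordinal d0 then tau else 0)).
have xi'E i : xi' i 0 = xi i 0 + (if i == Ordinal d0 then tau else 0) by rewrite mxE.
have sumxi' j : (0 < j)%N ->
    \sum_(i < d | (i < j)%N) xi' i 0 = \sum_(i < d | (i < j)%N) xi i 0 + tau.
  move=> j0; under eq_bigr do rewrite xi'E.
  rewrite big_split /=; congr (_ + _).
  rewrite (bigD1 (Ordinal d0)) //= ?eqxx big1 ?addr0 // => i /andP[_ /negPf ->] //.
have Kxi' : Kod xi'.
  move=> i j ij; rewrite !xi'E lerD ?Kxi //.
  case: (j =P _) => [jE|_]; last by case: ifP.
  have -> : i = Ordinal d0 by apply: val_inj => /=; move: ij; rewrite jE leqn0 => /eqP.
  by rewrite eqxx.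
have le_xi' i : xi i 0 <= xi' i 0 by rewrite xi'E lerDl; case: ifP.
apply: (@le_trans _ _ (\sum_(i < d | (i < r)%N) - lne (xi' i 0)%:E)%E).
  apply: ereal_inf_lbound; exists xi' => //; split=> //.
    by move=> i; apply: le_trans (xi0 i) (le_xi' i).
  split.
    rewrite -trace_eigvals //.
    have := sumxi' d d0; rewrite (eq_bigl predT) => [->|i]; last by rewrite ltn_ord.
    rewrite (eq_bigl predT) => [|i]; last by rewrite ltn_ord.
    by rewrite -trY /tau linearB /= addrC subrK.
  move=> j jd; have jd' : (j <= d)%N by rewrite (leq_trans jd) // leq_subr.
  have KX := Kod_eigvals symX; rewrite !topsumE //; case: j jd jd' => [|j] jd jd'.
    by rewrite !big_pred0.
  have [P fP <-] := trace_top_eigvals jd' symX.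
  rewrite sumxi' // -[X in P *m X](subrK Y) mulmxDr linearD /= addrC lerD ?domY //.
  have [trE domE] := dominates_eigvals psdE.
  apply: le_trans (domE _ _ jd' fP) _; rewrite /tau trE big_mkcond /=.
  by apply: ler_sum => i _; case: ifP => // _; apply: psd_eigvals_ge0.
rewrite -sumEFin; apply: lee_sum => i ir.
have x0 := xir i ir; have x0' : 0 < xi' i 0 by rewrite (lt_le_trans x0).
by rewrite lne_EFin // -EFinN lee_fin lerN2 ler_ln ?posrE.
Qed.

End Dominance.

(** * Induction over the hypersimplex *)
Section Hypersimplex.
Set Implicit Arguments.
Unset Strict Implicit.
Variable R : realType.

Definition in_cube d (x : 'rV[R]_d) := forall i, 0 <= x 0 i <= 1.

Definition fractional_set d (x : 'rV[R]_d) : {set 'I_d} := [set i | 0 < x 0 i < 1].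

(** The vertices of the hypersimplex are the indicators of the s-element
    sets. *)
Definition indicator_row d (T : {set 'I_d}) : 'rV[R]_d := \row_i (i \in T)%:R.

(** Mass is moved from j to i until one of the two entries becomes
    integral. *)
Lemma fractional_shift d (x : 'rV[R]_d) i j : in_cube x -> i != j ->
  i \in fractional_set x -> j \in fractional_set x -> exists t, 0 < t /\
  let y := x + t *: (delta_mx 0 i - delta_mx 0 j) in
  [/\ in_cube y, \sum_k y 0 k = \sum_k x 0 k & fractional_set y \proper fractional_set x].
Proof.
move=> x01 ij; rewrite !inE => /andP[i0 i1] /andP[j0 j1].
pose t := Num.min (1 - x 0 i) (x 0 j).
have ti : t <= 1 - x 0 i by rewrite /t ge_min lexx.
have tj : t <= x 0 j by rewrite /t ge_min lexx orbT.
have t0 : 0 < t by rewrite /t lt_min subr_gt0 i1.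
exists t; split=> // y.
have yE k : y 0 k = if k == i then x 0 i + t else if k == j then x 0 j - t else x 0 k.
  rewrite !mxE eqxx /=; have [->|ki] := eqVneq k i.
    by rewrite (negPf ij) /=; ring.
  by have [->|kj] := eqVneq k j => /=; ring.
split.
- move=> k; rewrite yE; case: ifP => _; first by apply/andP; split; lra.
  by case: ifP => _; [apply/andP; split; lra|exact: x01].
- rewrite (bigD1 i) // (bigD1 j) 1?eq_sym //= [RHS](bigD1 i) // (bigD1 j) 1?eq_sym //=.
  rewrite !yE eqxx eq_sym (negPf ij) eqxx !addrA; congr (_ + _); first by ring.
  by apply: eq_bigr => k /andP[/negPf ki /negPf kj]; rewrite yE ki kj.
- apply/properP; split.
    apply/fintype.subsetP => k; rewrite !inE yE; case: eqP => [-> _|_]; first by rewrite i0.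
    by case: eqP => [-> _|]; first by rewrite j0.
  have : (t == 1 - x 0 i) || (t == x 0 j).
    by rewrite /t; case: leP => _; rewrite eqxx ?orbT.
  case/orP => /eqP tE; [exists i|exists j]; rewrite inE ?i0 ?j0 // yE.
    by rewrite eqxx tE addrC subrK ltxx andbF.
  by rewrite eq_sym (negPf ij) eqxx tE subrr ltxx.
Qed.

(** The entries add up to an integer, so a fractional entry cannot be the only
    one. *)
Lemma fractional_partner d s (x : 'rV[R]_d) i : in_cube x -> \sum_k x 0 k = s%:R ->
  i \in fractional_set x -> exists2 j, i != j & j \in fractional_set x.
Proof.
move=> x01 xs ix.
have [/existsP[j /andP[ij jx]]|/existsPn h] := boolP [exists j, (i != j) && (j \in fractional_set x)].
  by exists j.
have x1 k : k != i -> x 0 k = (x 0 k == 1)%:R.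
  move=> ki; have := h k; rewrite eq_sym ki /= inE.
  have /andP[k0 k1] := x01 k; have [->//|k1'] := eqVneq (x 0 k) 1.
  by rewrite [X in _ && X]lt_neqAle k1' k1 /= andbT -leNgt => k0'; apply/eqP; rewrite eq_le k0 k0'.
move: xs; rewrite (bigD1 i) //= (eq_bigr _ x1) -natr_sum => xs.
move: ix; rewrite inE => /andP[i0 i1].
set n := (\sum_(_ < d | _) _)%N in xs.
have xE : x 0 i = s%:R - n%:R by rewrite -xs addrK.
move: i0 i1; rewrite xE subr_gt0 ltrBlDr -(natrD _ 1) !ltr_nat => ns.
by rewrite add1n ltnS leqNgt ns.
Qed.

(** Induction on the number of fractional entries.  A fractional entry has a
    fractional partner; shifting mass between the two, in one direction or the
    other, gives two points with fewer fractional entries, and x lies on the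
    segment between them. *)
Theorem hypersimplex_ind d s (P : 'rV[R]_d -> Prop) :
  (forall T : {set 'I_d}, #|T| = s -> P (indicator_row T)) ->
  (forall x y a b, 0 <= a -> 0 <= b -> a + b = 1 -> P x -> P y ->
     P (a *: x + b *: y)) ->
  forall x, in_cube x -> \sum_i x 0 i = s%:R -> P x.
Proof.
move=> PT Pconv x; have [n] := ubnP #|fractional_set x|; elim: n x => // n IHn x.
rewrite ltnS => xn x01 xs.
have [fx0|[i ix]] := set_0Vmem (fractional_set x).
  have xE : x = indicator_row [set i | x 0 i == 1].
    apply/rowP => i; rewrite !mxE inE; have /andP[i0 i1] := x01 i.
    have : i \notin fractional_set x by rewrite fx0 inE.
    rewrite inE; have [->//|i1'] := eqVneq (x 0 i) 1.
    by rewrite [X in _ && X]lt_neqAle i1' i1 /= andbT -leNgt => k0'; apply/eqP; rewrite eq_le i0 k0'.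
  rewrite xE; apply: PT; apply/eqP; rewrite -(eqr_nat R) -xs xE.
  rewrite -sum1_card natr_sum big_mkcond /=; apply/eqP/eq_bigr => i _.
  by rewrite mxE -xE; case: ifP.
have [j ij jx] := fractional_partner x01 xs ix.
have [t [t0 [y01 ys yx]]] := fractional_shift x01 ij ix jx.
have ji : j != i by rewrite eq_sym.
have [u [u0 [z01 zs zx]]] := fractional_shift x01 ji jx ix.
set y := x + t *: _ in y01 ys yx; set z := x + u *: _ in z01 zs zx.
have -> : x = (u / (t + u)) *: y + (t / (t + u)) *: z.
  by apply/rowP => k; rewrite !mxE; field; rewrite gt_eqF // addr_gt0.
have tu0 : 0 < t + u by rewrite addr_gt0.
apply: Pconv.
- by rewrite divr_ge0 // ltW.
- by rewrite divr_ge0 // ltW.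
- by field; rewrite gt_eqF.
- by apply: IHn => //; rewrite ?ys // (leq_trans (proper_card yx)).
- by apply: IHn => //; rewrite ?zs // (leq_trans (proper_card zx)).
Qed.

End Hypersimplex.

(** * The balancing weights *)
Section Scalar.
Set Implicit Arguments.
Unset Strict Implicit.
Local Open Scope classical_set_scope.
Variable R : realType.
Import numFieldNormedType.Exports.

Lemma prod_expr_pred d (z : R) (p : pred 'I_d) :
  \prod_i z ^+ p i = z ^+ #|[pred i | p i]|.
Proof.
by rewrite prodrXr -big_mkcond -sum1_card; congr (_ ^+ _).
Qed.

(** The product is a polynomial in z of degree at most the number of nonzero
    a_i, and it grows at least as fast as z^s. *)
Lemma card_support_ge d s (a b : 'I_d -> R) (c : R) : 0 < c ->
  (forall i, 0 <= a i) -> (forall i, 0 <= b i) ->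
  (forall z, 0 < z -> c * z ^+ s <= \prod_i (z * a i + b i)) ->
  (s <= #|[pred i | a i != 0%R]|)%N.
Proof.
move=> c0 a0 b0 cz; rewrite leqNgt; apply/negP; set k := #|_| => ks.
pose K := \prod_i (a i + b i).
have K0 : 0 <= K by apply: prodr_ge0 => i _; rewrite addr_ge0.
have bound z : 1 <= z -> c * z <= K.
  move=> z1; have z0 : 0 < z by rewrite (lt_le_trans ltr01).
  have : c * z ^+ s <= z ^+ k * K.
    apply: le_trans (cz z z0) _.
    have -> : z ^+ k * K = \prod_i (z ^+ (a i != 0) * (a i + b i)).
      rewrite big_split /=; congr (_ * _).
      by rewrite prod_expr_pred.
    apply: ler_prod => i _; rewrite addr_ge0 ?mulr_ge0 // ?(ltW z0) //=.
    have [->|ai] := eqVneq (a i) 0; first by rewrite /= mulr0 expr0 mul1r.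
    by rewrite /= expr1 mulrDr lerD2l ler_peMl.
  rewrite -(subnKC ks) addSnnS exprD mulrCA ler_pM2l ?exprn_gt0 //.
  apply: le_trans; by rewrite ler_pM2l // exprS ler_peMr ?(ltW z0) // exprn_ege1.
have := bound (K / c + 1).
rewrite lerDr divr_ge0 ?(ltW c0) // => /(_ isT).
rewrite mulrDr mulr1 mulrCA divff ?gt_eqF // mulr1; lra.
Qed.

(** If exactly s of the b_i vanish, the product is divisible by z^s, and the
    bound is the limit of the quotient as z tends to 0. *)
Lemma endpoint_bound d s (a b : 'I_d -> R) (c : R) :
  (forall z, 0 < z -> c * z ^+ s <= \prod_i (z * a i + b i)) ->
  #|[pred i | b i == 0]| = s ->
  c <= \prod_i (if b i == 0 then a i else b i).
Proof.
move=> cz bs.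
pose p : {poly R} := \prod_i (if b i == 0 then (a i)%:P else a i *: 'X + (b i)%:P).
have pE z : p.[z] = \prod_i (if b i == 0 then a i else z * a i + b i).
  rewrite horner_prod; apply: eq_bigr => i _.
  by case: ifP => _; rewrite !hornerE // mulrC.
have -> : \prod_i (if b i == 0 then a i else b i) = p.[0].
  by rewrite pE; apply: eq_bigr => i _; rewrite mul0r add0r.
have cp : horner p x @[x --> 0^'+] --> p.[0].
  by apply: cvg_at_right_filter; apply: continuous_horner.
apply: (cvgr_to_ge cp); near=> z.
have z0 : 0 < z by near: z; exact: nbhs_right_gt.
have zs : 0 < z ^+ s by rewrite exprn_gt0.
rewrite -(ler_pM2r zs) (le_trans (cz z z0)) // pE.
suff -> : z ^+ s = \prod_i z ^+ (b i == 0).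
  rewrite -big_split /= le_eqVlt; apply/orP; left; apply/eqP/eq_bigr => i _.
  by case: eqP => [->|_] /=; rewrite ?expr1 ?expr0 ?mulr1 ?addr0 // mulrC.
by rewrite prod_expr_pred bs.
Unshelve. all: by end_near. Qed.

Lemma prod_homogenize d s (a b : 'I_d -> R) (c : R) : (s <= d)%N ->
  (forall z, 0 < z -> c * z ^+ s <= \prod_i (z * a i + b i)) ->
  forall al be, 0 < al -> 0 < be ->
    c * al ^+ s * be ^+ (d - s) <= \prod_i (al * a i + be * b i).
Proof.
move=> sd cz al be al0 be0.
have -> : \prod_i (al * a i + be * b i) = be ^+ d * \prod_i (al / be * a i + b i).
  rewrite -[X in be ^+ X](card_ord d) -prodr_const -big_split /=.
  by apply: eq_bigr => i _; field; rewrite gt_eqF.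
have := cz (al / be) (divr_gt0 al0 be0).
rewrite -(ler_pM2l (exprn_gt0 d be0)); apply: le_trans.
rewrite -[X in be ^+ X * _](subnK sd) exprD expr_div_n.
rewrite le_eqVlt; apply/orP; left; apply/eqP; field.
by rewrite expf_neq0 // gt_eqF.
Qed.

(** The weights are x_i = z a_i / (z a_i + (1 - z) b_i), with z in [0,1]
    chosen by the intermediate value theorem so that they add up to s.  At
    z = 0 their sum is the number of vanishing b_i and at z = 1 the number of
    nonvanishing a_i, and the growth of the product places s between these
    two.  The inequalities with al and be are equalities when 0 < z < 1; at the
    two ends part of a or of b is dropped. *)
Lemma balancing_weights d s (a b : 'I_d -> R) (c : R) : (s <= d)%N -> 0 < c ->
  (forall i, 0 <= a i) -> (forall i, 0 <= b i) ->
  (forall z, 0 < z -> c * z ^+ s <= \prod_i (z * a i + b i)) ->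
  exists al be (x w : 'rV[R]_d), [/\ [/\ 0 < al, 0 < be,
      forall i, 0 <= x 0 i <= 1 & \sum_i x 0 i = s%:R],
    forall i, [/\ 0 < w 0 i, w 0 i * x 0 i <= al * a i
                & w 0 i * (1 - x 0 i) <= be * b i] &
    c * al ^+ s * be ^+ (d - s) <= \prod_i w 0 i].
Proof.
move=> sd c0 a0 b0 cz; have hom := prod_homogenize sd cz.
have cz' z : 0 < z -> c * z ^+ (d - s) <= \prod_i (z * b i + a i).
  move=> z0; have := hom 1 z ltr01 z0; rewrite expr1n mulr1 => /le_trans; apply.
  by apply: ler_prod => i _; rewrite mul1r addrC lexx addr_ge0 ?mulr_ge0 ?(ltW z0).
have ab0 i : 0 < a i + b i.
  rewrite lt0r addr_ge0 // andbT; apply/eqP => abi.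
  have := cz 1 ltr01; rewrite expr1n mulr1 (bigD1 i) //= mul1r abi mul0r.
  by rewrite leNgt c0.
have bN0 i : b i = 0 -> 0 < a i by move=> bi; have := ab0 i; rewrite bi addr0.
have aN0 i : a i = 0 -> 0 < b i by move=> bi; have := ab0 i; rewrite bi add0r.
have card_a := card_support_ge c0 a0 b0 cz.
have card_b : (#|[pred i | b i == 0%R]| <= s)%N.
  have dE : (#|[pred i | b i == 0%R]| + #|[pred i | b i != 0%R]| = d)%N.
    by rewrite -[RHS]card_ord -(cardC [pred i | b i == 0%R]).
  by have := card_support_ge c0 b0 a0 cz'; rewrite leq_subLR -[X in (X <= _)%N]dE leq_add2r.
(* The cases where b i or a i vanishes give the limit values of the weights,
   which makes each of them continuous on the whole of [0, 1]. *)
pose rho i z : R := if b i == 0 then 1 else if a i == 0 then 0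
                    else z * a i / (z * a i + (1 - z) * b i).
pose sigma z := \sum_i rho i z.
have den z i : 0 <= z <= 1 -> a i != 0 -> b i != 0 -> 0 < z * a i + (1 - z) * b i.
  move=> /andP[z0 z1] ai bi.
  have ai0 : 0 < a i by rewrite lt0r ai a0.
  have bi0 : 0 < b i by rewrite lt0r bi b0.
  by nra.
have cont_sigma : {within `[0, 1], continuous sigma}.
  apply: continuous_in_subspaceT => z; rewrite inE /= in_itv /= => z01.
  apply: cvg_big => [|i _]; first exact: add_continuous.
  rewrite /rho.
  case: ifPn => bi; first exact: cvg_cst.
  case: ifPn => ai; first exact: cvg_cst.
  have cz0 : z * a i + (1 - z) * b i != 0 by rewrite gt_eqF // den.
  by apply: cvgM; [|apply: cvgV => //; apply: cvgD]; apply: cvgM; 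
     try exact: cvg_cst; try exact: cvg_id; apply: cvgB; [exact: cvg_cst|exact: cvg_id].
have s0 : sigma 0 = #|[pred i | b i == 0%R]|%:R.
  rewrite -sum1_card natr_sum [RHS]big_mkcond /=; apply: eq_bigr => i _.
  by rewrite /rho inE; case: ifP => // _; case: ifP => // _; rewrite !mul0r.
have s1 : sigma 1 = #|[pred i | a i != 0%R]|%:R.
  rewrite -sum1_card natr_sum [RHS]big_mkcond /=; apply: eq_bigr => i _.
  rewrite /rho inE; case: ifP => [/eqP/bN0 ai|bi]; first by rewrite gt_eqF.
  by case: eqP => [//|/eqP ai]; rewrite subrr mul0r addr0 mul1r divff.
have [z z01 sz] : exists2 z, z \in `[0, 1]%R & sigma z = s%:R.
  apply: (IVT ler01 cont_sigma).
  by rewrite ge_min le_max s0 s1 !ler_nat card_a card_b orbT.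
rewrite in_itv /= in z01; have /andP[z0 z1] := z01.
have [zE|zN0] := eqVneq z 0.
  pose w : 'rV[R]_d := \row_i (if b i == 0 then a i else b i).
  pose x : 'rV[R]_d := \row_i (b i == 0)%:R.
  exists 1, 1, x, w; split; first split=> //.
  - by move=> i; rewrite mxE; case: (b i == 0); rewrite ?lexx ?ler01.
  - rewrite -sz zE s0 -sum1_card natr_sum [RHS]big_mkcond /=; apply: eq_bigr => i _.
    by rewrite mxE inE; case: ifP.
  - move=> i; rewrite !mxE; case: eqP => [bi|/eqP bi] /=.
      by rewrite bi subrr !mulr0 mul1r mulr1 bN0.
    by rewrite mulr0 subr0 mulr1 !mul1r lt0r bi b0 a0.
  - rewrite !expr1n !mulr1; under [leRHS]eq_bigr do rewrite mxE.
    apply: endpoint_bound cz _; apply/eqP; rewrite -(eqr_nat R) -s0 -zE sz //.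
have [zE|zN1] := eqVneq z 1.
  pose w : 'rV[R]_d := \row_i (if a i == 0 then b i else a i).
  pose x : 'rV[R]_d := \row_i (a i != 0)%:R.
  exists 1, 1, x, w; split; first split=> //.
  - by move=> i; rewrite mxE; case: (a i != 0); rewrite ?lexx ?ler01.
  - rewrite -sz zE s1 -sum1_card natr_sum [RHS]big_mkcond /=; apply: eq_bigr => i _.
    by rewrite mxE inE; case: ifP.
  - move=> i; rewrite !mxE; case: eqP => [ai|/eqP ai] /=.
      by rewrite ai subr0 !mulr0 mul1r mulr1 aN0.
    by rewrite subrr mulr0 mulr1 !mul1r lt0r ai a0 b0.
  - rewrite !expr1n !mulr1; under [leRHS]eq_bigr do rewrite mxE.
    apply: endpoint_bound cz' _; apply/eqP.
    have /eqP := sz; rewrite zE s1 eqr_nat => /eqP <-.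
    by rewrite -[d in (d - _)%N]card_ord -(cardC [pred i | a i == 0%R]) addnK.
have z_gt0 : 0 < z by rewrite lt0r zN0.
have z_lt1 : 0 < 1 - z by rewrite subr_gt0 lt_neqAle zN1.
pose w : 'rV[R]_d := \row_i (z * a i + (1 - z) * b i).
pose x : 'rV[R]_d := \row_i (rho i z).
have w0 i : 0 < w 0 i.
  rewrite mxE; have [ai|ai] := eqVneq (a i) 0.
    by rewrite ai mulr0 add0r mulr_gt0 // aN0.
  by rewrite ltr_pwDl ?(mulr_ge0 (ltW z_lt1)) // mulr_gt0 // lt0r ai a0.
have xE i : x 0 i = z * a i / w 0 i.
  rewrite !mxE /rho; case: eqP => [bi|_].
    by rewrite bi mulr0 addr0 divff // mulf_neq0 // gt_eqF // bN0.
  by case: eqP => [->|//]; rewrite mulr0 mul0r.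
exists z, (1 - z), x, w; split; first split=> //.
- move=> i; rewrite xE; apply/andP; split.
    by rewrite divr_ge0 ?(ltW (w0 i)) ?mulr_ge0.
  by rewrite ler_pdivrMr // mul1r mxE lerDl mulr_ge0 // ltW.
- by rewrite -sz; apply: eq_bigr => i _; rewrite mxE.
- move=> i; have wN0 : w 0 i != 0 by rewrite gt_eqF.
  have wx : w 0 i * x 0 i = z * a i by rewrite xE mulrC divfK.
  split=> //; first by rewrite wx.
  by rewrite mulrBr wx mulr1 mxE addrAC subrr add0r.
- under [leRHS]eq_bigr do rewrite mxE.
  exact: hom.
Qed.

End Scalar.

(** * The matrix inequality *)
Section Core.
Set Implicit Arguments.
Unset Strict Implicit.
Variable R : realType.

Lemma psd_ii_ge0 n (M : 'M[R]_n) i : psd M -> 0 <= M i i.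
Proof.
by move=> [_ /(_ (row i 1%:M))]; rewrite quad_form_row trmx1 mulmx1 mul1mx.
Qed.

Lemma congr_diag_lin d (S : 'M[R]_d) (u v : 'rV[R]_d) a b :
  S *m diag_mx (a *: u + b *: v) *m S^T =
  a *: (S *m diag_mx u *m S^T) + b *: (S *m diag_mx v *m S^T).
Proof.
by rewrite linearD !linearZ /= mulmxDr mulmxDl -!scalemxAr -!scalemxAl.
Qed.

(** With M + N = L L^T, an orthogonal matrix diagonalizing L^-1 M L^-T also
    diagonalizes L^-1 N L^-T, which is the identity minus it. *)
Lemma simultaneous_congruence d (M N : 'M[R]_d) : psd M -> psd N -> 0 < \det (M + N) ->
  exists (S : 'M[R]_d) (a b : 'rV[R]_d),
  [/\ S \in unitmx, forall i, 0 <= a 0 i, forall i, 0 <= b 0 i,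
      M = S *m diag_mx a *m S^T & N = S *m diag_mx b *m S^T].
Proof.
move=> psdM psdN detW; have psdW := psdD psdM psdN; have [symW _] := psdW.
have [U [UU WE]] := sym_eigvals symW; set l := eigvals (M + N) in WE.
have l0 i : 0 <= l i 0 by exact: psd_eigvals_ge0.
pose q : 'rV[R]_d := \row_i Num.sqrt (l i 0).
have [L LL] : exists L : 'M[R]_d, L *m L^T = M + N.
  exists (U^T *m diag_mx q); rewrite WE trmx_mul trmxK tr_diag_mx -!mulmxA; congr (_ *m _).
  rewrite mulmxA mulmx_diag; congr (diag_mx _ *m _).
  by apply/rowP => i; rewrite !mxE -expr2 sqr_sqrtr.
have uL : L \in unitmx.
  rewrite unitmxE unitfE; apply/eqP => L0; move: detW.
  by rewrite -LL det_mulmx L0 mul0r ltxx.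
pose K := invmx L *m M *m (invmx L)^T.
have psdK : psd K by exact: psd_congr.
have [symK _] := psdK; have [Q [QQ KE]] := sym_eigvals symK.
have [k k0 {}KE] : exists2 k : 'rV[R]_d, forall i, 0 <= k 0 i &
    K = Q^T *m diag_mx k *m Q.
  by exists (eigvals K)^T => // i; rewrite mxE; exact: psd_eigvals_ge0.
have [S SE] : exists S, S = L *m Q^T by exists (L *m Q^T).
have SS : S *m S^T = M + N.
  by rewrite SE trmx_mul trmxK mulmxA -(mulmxA L) (mulmx1C QQ) mulmx1.
have uS : S \in unitmx by rewrite SE unitmx_mul uL unitmx_tr; case: (mulmx1_unit QQ).
have ME : M = S *m diag_mx k *m S^T.
  transitivity (L *m K *m L^T).
    rewrite /K !mulmxA mulmxV // mul1mx -mulmxA -trmx_mul mulmxV //.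
    by rewrite trmx1 mulmx1.
  by rewrite [in LHS]KE SE trmx_mul trmxK !mulmxA.
have NE : N = S *m diag_mx (const_mx 1 - k) *m S^T.
  rewrite linearB /= diag_const_mx mulmxBr mulmx1 mulmxBl -ME SS.
  by rewrite addrAC subrr add0r.
exists S, k, (const_mx 1 - k); split=> //.
move=> i; have := psd_ii_ge0 i (psd_congr (invmx S) psdN).
rewrite {1}NE !mulmxA mulVmx // mul1mx -mulmxA -trmx_mul mulVmx // trmx1 mulmx1.
by rewrite !mxE eqxx mulr1n.
Qed.

Lemma ln_prod (I : finType) (P : pred I) (F : I -> R) :
  (forall i, P i -> 0 < F i) -> ln (\prod_(i | P i) F i) = \sum_(i | P i) ln (F i).
Proof.
move=> F0; suff [] : 0 < \prod_(i | P i) F i /\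
  ln (\prod_(i | P i) F i) = \sum_(i | P i) ln (F i) by [].
apply: (big_ind2 (fun x y => 0 < x /\ ln x = y)); first by rewrite ln1.
- by move=> x u y v [x0 <-] [y0 <-]; rewrite mulr_gt0 // lnM.
- by move=> i Pi; rewrite F0.
Qed.

(** The positivity of the first r entries keeps the objective of G_r
    finite. *)
Definition admissible d r (xi : 'cV[R]_d) (M : 'M[R]_d) :=
  [/\ dominates xi M, nonnegv xi, Kod xi & forall i : 'I_d, (i < r)%N -> 0 < xi i 0].

Definition top_lnsum d r (xi : 'cV[R]_d) := \sum_(i < d | (i < r)%N) ln (xi i 0).

(** Domination is closed under nonnegative combinations of pairs (xi, M), and
    the sum of logarithms is concave in xi. *)
Lemma admissible_lin d r (xi yi : 'cV[R]_d) M N (a b : R) : 0 <= a -> 0 <= b -> a + b = 1 ->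
  admissible r xi M -> admissible r yi N ->
  admissible r (a *: xi + b *: yi) (a *: M + b *: N) /\
  a * top_lnsum r xi + b * top_lnsum r yi <= top_lnsum r (a *: xi + b *: yi).
Proof.
move=> a0 b0 ab [dxi xi0 Kxi xir] [dyi yi0 Kyi yir].
have pos (i : 'I_d) : (i < r)%N -> 0 < a * xi i 0 + b * yi i 0.
  move=> ir; have := xir i ir; have := yir i ir; move: (xi i 0) (yi i 0) => u v v0 u0.
  have [a1|aN0] := eqVneq a 0.
    by move: ab; rewrite a1 add0r => ->; rewrite mul0r add0r mul1r.
  by rewrite ltr_pwDl ?(mulr_ge0 b0 (ltW v0)) // mulr_gt0 // lt0r aN0.
split.
  split; first exact: dominates_lin.
  - by move=> i; rewrite !mxE addr_ge0 ?mulr_ge0.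
  - by move=> i j ij; rewrite !mxE lerD // ler_wpM2l ?Kxi ?Kyi.
  - by move=> i ir; rewrite !mxE pos.
rewrite /top_lnsum !mulr_sumr -big_split /=; apply: ler_sum => i ir; rewrite !mxE.
have a1 : a <= 1 by rewrite -ab lerDl.
have := @concave_ln R (Itv01 a0 a1) _ _ (xir i ir) (yir i ir).
rewrite !convRE /=.
by have -> : unstable.onem a = b by rewrite /unstable.onem -ab addrAC subrr add0r.
Qed.

(** The two matrices have ranks at most s and d - s, and their spectra are the
    required vectors. *)
Lemma admissible_pair_indicator d s (S : 'M[R]_d) (w : 'rV[R]_d) (T : {set 'I_d}) :
  S \in unitmx -> (forall i, 0 < w 0 i) -> #|T| = s ->
  exists xi eta : 'cV[R]_d,
  [/\ admissible s xi (S *m diag_mx (\row_i (w 0 i * indicator_row R T 0 i)) *m S^T),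
      admissible (d - s) eta (S *m diag_mx (\row_i (w 0 i * (1 - indicator_row R T 0 i))) *m S^T) &
      ln (\det (S *m diag_mx w *m S^T)) <= top_lnsum s xi + top_lnsum (d - s) eta].
Proof.
move=> uS w0 Ts.
set M := S *m _ *m _; set N := S *m _ *m _.
have sd : (s <= d)%N by rewrite -Ts -[d in (_ <= d)%N]card_ord max_card.
have psdM : psd M.
  by apply/psd_congr/psd_diag => i; rewrite !mxE mulr_ge0 ?ler0n ?(ltW (w0 i)).
have psdN : psd N.
  apply/psd_congr/psd_diag => i; rewrite !mxE mulr_ge0 ?(ltW (w0 i)) //.
  by case: (_ \in _); rewrite ?subr0 ?subrr ?ler01.
have rM : (\rank M <= s)%N.
  rewrite (leq_trans (mxrankM_maxl _ _)) // (leq_trans (mxrankM_maxr _ _)) //.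
  by rewrite -Ts rank_diag_le // => i /negPf iT; rewrite !mxE iT mulr0.
have rN : (\rank N <= d - s)%N.
  rewrite (leq_trans (mxrankM_maxl _ _)) // (leq_trans (mxrankM_maxr _ _)) //.
  have -> : (d - s)%N = #|~: T| by rewrite cardsCs finset.setCK card_ord Ts.
  by rewrite rank_diag_le // => i; rewrite inE negbK => iT; rewrite !mxE iT subrr mulr0.
have MN : S *m diag_mx w *m S^T = M + N.
  rewrite /M /N -mulmxDl -mulmxDr -linearD /=; congr (_ *m diag_mx _ *m _).
  by apply/rowP => i; rewrite !mxE; ring.
have detW : 0 < \det (S *m diag_mx w *m S^T).
  rewrite !det_mulmx det_tr mulrAC -expr2 det_diag mulr_gt0 ?prodr_gt0 //.
  by rewrite exprn_even_gt0 //= -unitfE -unitmxE.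
have := det_add_le_prod_top_eigvals sd psdM psdN rM rN; rewrite -MN => le_det.
have /andP[] : (\prod_(i < d | (i < s)%N) eigvals M i 0 != 0) &&
    (\prod_(i < d | (i < d - s)%N) eigvals N i 0 != 0).
  by rewrite -negb_or -mulf_eq0 gt_eqF // (lt_le_trans detW).
move=> /prodf_neq0 M0 /prodf_neq0 N0.
have Mp (i : 'I_d) : (i < s)%N -> 0 < eigvals M i 0.
  by move=> ir; rewrite lt0r M0 // psd_eigvals_ge0.
have Np (i : 'I_d) : (i < d - s)%N -> 0 < eigvals N i 0.
  by move=> ir; rewrite lt0r N0 // psd_eigvals_ge0.
exists (eigvals M), (eigvals N); split.
- split=> //; [exact: dominates_eigvals|by move=> i; exact: psd_eigvals_ge0|].
  by apply: Kod_eigvals; case: psdM.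
- split=> //; [exact: dominates_eigvals|by move=> i; exact: psd_eigvals_ge0|].
  by apply: Kod_eigvals; case: psdN.
- have -> : top_lnsum s (eigvals M) = ln (\prod_(i < d | (i < s)%N) eigvals M i 0).
    by rewrite ln_prod.
  have -> : top_lnsum (d - s) (eigvals N) =
      ln (\prod_(i < d | (i < d - s)%N) eigvals N i 0).
    by rewrite ln_prod.
  by rewrite -lnM ?ler_ln ?posrE ?mulr_gt0 // prodr_gt0.
Qed.

(** Both requirements survive averaging, by [admissible_lin], so the indicators
    of s-element sets decide. *)
Lemma admissible_pair d s (S : 'M[R]_d) (w x : 'rV[R]_d) :
  S \in unitmx -> (forall i, 0 < w 0 i) -> in_cube x -> \sum_i x 0 i = s%:R ->
  exists xi eta : 'cV[R]_d,
  [/\ admissible s xi (S *m diag_mx (\row_i (w 0 i * x 0 i)) *m S^T),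
      admissible (d - s) eta (S *m diag_mx (\row_i (w 0 i * (1 - x 0 i))) *m S^T) &
      ln (\det (S *m diag_mx w *m S^T)) <= top_lnsum s xi + top_lnsum (d - s) eta].
Proof.
move=> uS w0; move: x; apply: hypersimplex_ind => [T|x y a b a0 b0 ab].
  exact: admissible_pair_indicator.
move=> [xi [eta [xM eN xe]]] [yi [zeta [yM zN yz]]].
have [xyM le1] := admissible_lin a0 b0 ab xM yM.
have [ezN le2] := admissible_lin a0 b0 ab eN zN.
exists (a *: xi + b *: yi), (a *: eta + b *: zeta); split.
- move: xyM; rewrite -congr_diag_lin.
  congr (admissible _ _ (_ *m diag_mx _ *m _)).
  by apply/rowP => i; rewrite !mxE; ring.
- move: ezN; rewrite -congr_diag_lin.
  congr (admissible _ _ (_ *m diag_mx _ *m _)).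
  apply/rowP => i; rewrite !mxE.
  have -> : a = 1 - b by rewrite -ab addrK.
  by ring.
- set D := ln _ in xe yz *; have -> : D = a * D + b * D by rewrite -mulrDl ab mul1r.
  apply: le_trans (lerD le1 le2); rewrite addrACA -!mulrDr.
  by rewrite lerD // ler_wpM2l.
Qed.

Lemma top_lnsumZ d r (xi : 'cV[R]_d) t : (r <= d)%N -> 0 < t ->
  (forall i : 'I_d, (i < r)%N -> 0 < xi i 0) ->
  top_lnsum r (t^-1 *: xi) = top_lnsum r xi - r%:R * ln t.
Proof.
move=> rd t0 xir; rewrite /top_lnsum.
rewrite (eq_bigr (fun i => ln (xi i 0) - ln t)); last first.
  by move=> i ir; rewrite mxE lnM ?posrE ?invr_gt0 ?xir // lnV ?posrE // addrC.
rewrite sumrB; congr (_ - _).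
rewrite -(sum_ord_lt R rd) mulr_suml big_mkcond /=; apply: eq_bigr => i _.
by case: ifP; rewrite ?mul1r ?mul0r.
Qed.

(** The matrix form of the theorem: the infimum over z of
    log det (z M + N) - s log z is at most - G_s(M) - G_(d-s)(N). *)
Theorem G_add_le d s (M N : 'M[R]_d) (c : R) : (0 < d)%N -> (s <= d)%N ->
  psd M -> psd N -> 0 < c ->
  (forall z, 0 < z -> c * z ^+ s <= \det (z *: M + N)) ->
  (G s M + G (d - s) N <= (- ln c)%:E)%E.
Proof.
move=> d0 sd psdM psdN c0 cz.
have detMN : 0 < \det (M + N).
  by have := cz 1 ltr01; rewrite expr1n mulr1 scale1r; apply: lt_le_trans.
have [S [a [b [uS a0 b0 ME NE]]]] := simultaneous_congruence psdM psdN detMN.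
have D0 : 0 < \det S ^+ 2 by rewrite exprn_even_gt0 //= -unitfE -unitmxE.
have detS (l : 'rV[R]_d) : \det (S *m diag_mx l *m S^T) = \det S ^+ 2 * \prod_i l 0 i.
  by rewrite !det_mulmx det_tr mulrAC -expr2 det_diag.
have cz' z : 0 < z -> c / \det S ^+ 2 * z ^+ s <= \prod_i (z * a 0 i + b 0 i).
  move=> z0; rewrite mulrAC ler_pdivrMr // mulrC.
  have -> : \prod_i (z * a 0 i + b 0 i) = \prod_i (z *: a + b) 0 i.
    by apply: eq_bigr => i _; rewrite !mxE.
  rewrite [leRHS]mulrC -detS linearD linearZ /= mulmxDr mulmxDl -scalemxAr -scalemxAl.
  by rewrite -ME -NE mulrC cz.
have [al [be [x [w [[al0 be0 x01 xs] wab cw]]]]] :=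
  balancing_weights sd (divr_gt0 c0 D0) a0 b0 cz'.
have w0 i : 0 < w 0 i by case: (wab i).
have [xi [eta [[dxi xi0 Kxi xir] [deta eta0 Keta etar] le_ln]]] :=
  admissible_pair uS w0 x01 xs.
have bound r t (K : 'M[R]_d) k (v : 'rV[R]_d) (yi : 'cV[R]_d) : 0 < t -> (r <= d)%N ->
    psd K -> K = S *m diag_mx k *m S^T -> (forall i, v 0 i <= t * k 0 i) ->
    admissible r yi (S *m diag_mx v *m S^T) ->
    (G r K <= (r%:R * ln t - top_lnsum r yi)%:E)%E.
  move=> t0 rd psdK KE vk [dyi yi0 Kyi yir].
  have := @G_le_dominates R d r K (t^-1 *: (S *m diag_mx v *m S^T)) (t^-1 *: yi) d0.
  have ti : 0 <= t^-1 by rewrite invr_ge0 ltW.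
  rewrite sumrN -/(top_lnsum _ _) top_lnsumZ // opprB; apply.
  - by case: psdK.
  - rewrite {1}KE scalemxAl scalemxAr -linearZ -mulmxBl -mulmxBr -linearB /=.
    apply/psd_congr/psd_diag => i; rewrite !mxE subr_ge0.
    by rewrite mulrC ler_pdivrMr // mulrC.
  - exact: dominatesZ.
  - by move=> i; rewrite mxE mulr_ge0.
  - by move=> i j ij; rewrite !mxE ler_wpM2l // Kyi.
  - by move=> i ir; rewrite mxE mulr_gt0 ?invr_gt0 // yir.
have GM := bound s al M a _ xi al0 sd psdM ME _ (And4 dxi xi0 Kxi xir).
have GN := bound (d - s)%N be N b _ eta be0 (leq_subr _ _) psdN NE _ (And4 deta eta0 Keta etar).
apply: le_trans (leeD (GM _) (GN _)) _ => [i|i|]; rewrite ?mxE; [by case: (wab i)..|].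
rewrite -EFinD lee_fin.
have : ln (c * al ^+ s * be ^+ (d - s)) <= ln (\det (S *m diag_mx w *m S^T)).
  rewrite ler_ln ?posrE ?mulr_gt0 ?exprn_gt0 //; last first.
    by rewrite detS mulr_gt0 // prodr_gt0.
  rewrite detS; move: cw; rewrite -(ler_pM2l D0); apply: le_trans.
  by rewrite !mulrA [_ * c]mulrC mulfK ?gt_eqF.
have -> : ln (c * al ^+ s * be ^+ (d - s)) =
    ln c + s%:R * ln al + (d - s)%:R * ln be.
  have [als bes] := (exprn_gt0 s al0, exprn_gt0 (d - s) be0).
  have cals : 0 < c * al ^+ s by rewrite mulr_gt0.
  by rewrite (lnM cals bes) (lnM c0 als) !lnXn // !mulr_natl.
move: le_ln; lra.
Qed.

End Core.

(** * From the matrix inequality to the bounds *)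
Section Assembly.
Set Implicit Arguments.
Unset Strict Implicit.
Variable R : realType.
Local Open Scope classical_set_scope.
Local Open Scope ereal_scope.

(** Since log t <= t, the objective is at least minus the sum of the entries of
    xi, and this sum is prescribed by X. *)
Lemma G_gtNy d r (X : 'M[R]_d) : -oo < G r X.
Proof.
apply: (@lt_le_trans _ _ (- \sum_i eigvals X i 0)%R%:E); first exact: ltNyr.
apply: le_ereal_inf_tmp => _ [xi [xi0 [sumxi _] _] <-].
rewrite -sumxi -sumrN -sumEFin [leRHS]big_mkcond /=; apply: lee_sum => i _.
case: ifP => _; last by rewrite lee_fin oppr_le0 xi0.
rewrite EFinN leeN2; apply: ltW.
exact: (@lne_sublinear _ (xi i 0)%:E isT).
Qed.

Lemma f_Gamma_g_gtNy d (V : 'M[R]_d) s x rho : -oo < f_Gamma_g V s x rho.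
Proof.
by rewrite /f_Gamma_g ltNye adde_eq_ninfty orbF -ltNye G_gtNy.
Qed.

Lemma f_Gammac_g_gtNy d (C V : 'M[R]_d) s x omega :
  -oo < f_Gammac_g C V s x omega.
Proof.
rewrite /f_Gammac_g ltNye !adde_eq_ninfty orbF negb_or -!ltNye G_gtNy /=.
by case: ifP => _; rewrite -?EFinN ?ltNyr ?ltNyy.
Qed.

Lemma le_real_ub (x y : \bar R) :
  (forall r : R, y <= r%:E -> x <= r%:E) -> x <= y.
Proof.
case: y => [r|_|h]; [exact|exact: leey|].
case: x h => [r h|h|_//].
- by have := h (r - 1)%R (leNye _); rewrite lee_fin => ?; exfalso; lra.
- by have := h 0%R (leNye _).
Qed.

(** Since A contains some a > -oo, the bound makes every element of B finite,
    and each supremum can be taken after subtracting such an element. *)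
Lemma ereal_sup_add_le (A B : set (\bar R)) (u : R) :
  A !=set0 -> B !=set0 ->
  (forall a, A a -> -oo < a) -> (forall b, B b -> -oo < b) ->
  (forall a b, A a -> B b -> a + b <= u%:E) ->
  ereal_sup A + ereal_sup B <= u%:E.
Proof.
move=> [a0 Aa0] [b0 Bb0] A0 B0 AB.
have Bfin b : B b -> b \is a fin_num.
  move=> Bb; have := AB _ _ Aa0 Bb; have := A0 _ Aa0; have := B0 _ Bb.
  by move: a0 b {Aa0 Bb} => [r| |] [r'| |].
have supA b : B b -> ereal_sup A <= u%:E - b.
  move=> Bb; apply: ge_ereal_sup => a Aa.
  by rewrite leeBrDr ?Bfin // AB.
have fA : ereal_sup A \is a fin_num.
  rewrite fin_numElt; apply/andP; split.
    by apply: lt_le_trans (A0 _ Aa0) _; apply: ereal_sup_ubound.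
  apply: le_lt_trans (supA _ Bb0) _.
  by move: (Bfin _ Bb0); case: b0 {Bb0} => // r _; rewrite -EFinB ltry.
rewrite addeC -leeBrDr //; apply: ge_ereal_sup => b Bb.
by rewrite leeBrDr // addeC -leeBrDr ?Bfin // supA.
Qed.

(** A finite objective value forces the determinant to be positive, and the
    inequality can then be exponentiated. *)
Lemma expR_le_det_linx d (C : 'M[R]_d) (x rho omega : 'cV[R]_d) (T : R) :
  f_linx_d C x rho omega <= T%:E ->
  let D := (\det (C *m Diag (expv rho) *m Diag x *m C
                 + Diag (expv omega) *m Diag (onev R d - x)))%R in
  (expR (\sum_(i < d) x i 0 * rho i 0 + \sum_(i < d) (1 - x i 0) * omega i 0
    - 2 * T) <= D)%R.
Proof.
rewrite /f_linx_d; set D := (\det _)%R; set A := (\sum_(i < d) _)%R.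
set B := (\sum_(i < d) _)%R => h /=.
have [D0|D0] := leP D 0%R.
  by move: h; rewrite le0_lneNy ?lee_fin // -[- -oo]/(+oo) gt0_muley ?lte_fin ?invr_gt0.
move: h; rewrite lne_EFin // -EFinN -EFinM -!EFinD lee_fin => h.
by rewrite -[leRHS](lnK D0) ler_expR; lra.
Qed.

(** The one-parameter scaling is the diagonal one along constant vectors,
    because the entries of x add up to s. *)
Lemma f_linx_o_d d (C : 'M[R]_d) s (x : 'cV[R]_d) (t : R) : (\sum_i x i 0)%R = s%:R ->
  f_linx_o C s x t = f_linx_d C x (0 + const_mx t)%R 0%R.
Proof.
move=> xs; rewrite /f_linx_o /f_linx_d add0r.
have -> : (\sum_(i < d) (1 - x i 0) * (0 : 'cV[R]_d) i 0 = 0)%R.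
  by apply: big1 => i _; rewrite mxE mulr0.
rewrite mulr0 adde0; congr (_ * - lne (\det _)%:E + _%:E).
  have -> : Diag (expv (const_mx t)) = (expR t)%:M :> 'M[R]_d.
    by rewrite /Diag /expv map_const_mx trmx_const diag_const_mx.
  have -> : Diag (expv 0) = 1%:M :> 'M[R]_d.
    rewrite /Diag /expv -diag_const_mx; congr diag_mx.
    by apply/rowP => i; rewrite !mxE expR0.
  by rewrite mul1mx mul_mx_scalar -!scalemxAl.
rewrite -mulrA; congr (_ * _)%R; rewrite -xs mulr_suml.
by apply: eq_bigr => i _; rewrite mxE.
Qed.

(** Moving rho along constant vectors turns the bound T into the hypothesis of
    [G_add_le], with z = e^t. *)
Lemma Gamma_sum_le_linx d s (C V : 'M[R]_d) (x rho omega : 'cV[R]_d) (T : R) :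
  (0 < d)%N -> (s <= d)%N -> V \in unitmx -> C = (V^T *m V)%R ->
  (forall i, 0 <= x i 0 <= 1)%R -> (\sum_i x i 0)%R = s%:R ->
  (forall t : R, f_linx_d C x (rho + const_mx t)%R omega <= T%:E) ->
  f_Gamma_g V s x rho + f_Gammac_g C V s x omega <= (2 * T)%:E.
Proof.
move=> d0 sd uV CE x01 xs linx.
rewrite /f_Gamma_g /f_Gammac_g.
set M := (V *m _ *m _ *m _)%R; set N := (invmx _ *m _ *m _ *m _)%R.
set A := (\sum_(i < d) x i 0 * _)%R; set B := (\sum_(i < d) (1 - _) * _)%R.
have psdM : psd M.
  rewrite /M -[(V *m _ *m _)%R]mulmxA mulmx_diag; apply/psd_congr/psd_diag => i.
  by rewrite !mxE mulr_ge0 ?expR_ge0 //; case/andP: (x01 i).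
have psdN : psd N.
  have -> : N = (invmx V^T *m (Diag (expv omega) *m Diag (onev R d - x)) *m (invmx V^T)^T)%R.
    by rewrite trmx_inv trmxK !mulmxA.
  rewrite mulmx_diag; apply/psd_congr/psd_diag => i.
  by rewrite !mxE mulr_ge0 ?expR_ge0 // subr_ge0; case/andP: (x01 i).
have detC : \det C = (\det V ^+ 2)%R by rewrite CE det_mulmx det_tr.
have C0 : (0 < \det C)%R by rewrite detC exprn_even_gt0 //= -unitfE -unitmxE.
have uVt : (V^T)%R \in unitmx by rewrite unitmx_tr.
have detE t : (\det (C *m Diag (expv (rho + const_mx t)) *m Diag x *m C
      + Diag (expv omega) *m Diag (onev R d - x)) =
    \det C * \det (expR t *: M + N))%R.
  transitivity (\det (V^T *m (expR t *: M + N) *m V))%R; last first.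
    by rewrite !det_mulmx det_tr detC mulrAC expr2.
  congr (\det _)%R; rewrite mulmxDr mulmxDl; congr (_ + _)%R; last first.
    by rewrite /N !mulmxA mulmxV // mul1mx mulmxKV.
  have -> : Diag (expv (rho + const_mx t)) = (expR t *: Diag (expv rho))%R.
    rewrite /Diag -linearZ; congr diag_mx; apply/rowP => i.
    by rewrite !mxE expRD mulrC.
  by rewrite CE /M -scalemxAr -!scalemxAl -scalemxAr -!scalemxAl !mulmxA.
pose k := (A + B - 2 * T)%R.
have key : G s M + G (d - s) N <= (- ln (expR k / \det C))%:E.
  apply: G_add_le => //; first by rewrite divr_gt0 ?expR_gt0.
  move=> z z0; have := expR_le_det_linx (linx (ln z)).
  rewrite detE lnK ?posrE // mulrAC ler_pdivrMr // [leRHS]mulrC.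
  apply: le_trans; rewrite -[z in leLHS](lnK z0) -expRM_natl -expRD ler_expR /k.
  have -> : (\sum_(i < d) x i 0 * (rho + const_mx (ln z))%R i 0 = A + s%:R * ln z)%R.
    by rewrite -xs mulr_suml -big_split /=; apply: eq_bigr => i _; rewrite !mxE mulrDr.
  by rewrite -/B; lra.
rewrite lnM ?posrE ?expR_gt0 ?invr_gt0 // expRK lnV ?posrE // in key.
rewrite lne_EFin //.
have := G_gtNy s M; have := G_gtNy (d - s) N; move: key.
case: (G s M) => [r| |]; case: (G (d - s) N) => [q| |] //.
rewrite -!EFinD -?EFinN !lee_fin /k; lra.
Qed.

Lemma half_le (z : \bar R) (T : R) : z <= (2 * T)%:E -> (2^-1)%:E * z <= T%:E.
Proof.
move=> zT; have -> : T = (2^-1 * (2 * T))%R by rewrite mulKf.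
by rewrite EFinM lee_wpmul2l // lee_fin invr_ge0.
Qed.

End Assembly.

Local Open Scope ereal_scope.

(* The case m = 0 is the one without additional linear constraints. *)
Theorem corollary3 (R : realType) (d s m : nat) (C V : 'M[R]_d)
    (A : 'M[R]_(m, d)) (b : 'cV[R]_m)
    (hs : (1 <= s <= d - 1)%N)
    (hV : \rank V = d)
    (hC : C = (V^T *m V)%R) :
  let X := feasible s A b in
  ((2^-1)%:E * (Opt_Gamma V s X + Opt_Gammac C V s X) <= Opt_linx_o C s X) /\
  ((2^-1)%:E * (Opt_Gamma_g V s X + Opt_Gammac_g C V s X) <= Opt_linx_d C X).
Proof.
move=> X; have /andP[s1 sd1] := hs.
have sd : (s <= d)%N by rewrite (leq_trans sd1) // leq_subr.
have d0 : (0 < d)%N by exact: leq_trans sd.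
have uV : V \in unitmx by rewrite -row_free_unit /row_free hV.
split; apply: le_ereal_inf_tmp => _ [x Xx <-]; have [x01 xs _] := Xx;
  apply: le_real_ub => T supT; apply: half_le.
- have linx t : (f_linx_d C x (0 + const_mx t)%R 0%R <= T%:E)%E.
    rewrite -(f_linx_o_d C t xs); apply: le_trans supT.
    by apply: ereal_sup_ubound; exists t.
  apply: le_trans (Gamma_sum_le_linx d0 sd uV hC x01 xs linx).
  by apply: leeD; apply: ereal_inf_lbound; exists x.
- have pair rho omega : (f_Gamma_g V s x rho + f_Gammac_g C V s x omega <= (2 * T)%:E)%E.
    apply: Gamma_sum_le_linx => // t; apply: le_trans supT.
    by apply: ereal_sup_ubound; exists (rho + const_mx t, omega)%R.
  apply: (@le_trans _ _ (ereal_sup [set f_Gamma_g V s x rho | rho in setT]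
      + ereal_sup [set f_Gammac_g C V s x omega | omega in setT])%E).
    by apply: leeD; apply: ereal_inf_lbound; exists x.
  apply: ereal_sup_add_le.
  + by exists (f_Gamma_g V s x 0%R); exists 0%R.
  + by exists (f_Gammac_g C V s x 0%R); exists 0%R.
  + by move=> _ [rho _ <-]; exact: f_Gamma_g_gtNy.
  + by move=> _ [omega _ <-]; exact: f_Gammac_g_gtNy.
  + by move=> _ _ [rho _ <-] [omega _ <-]; exact: pair.
Qed.
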